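(* Let $\mathbb L$ be a finite nonempty set of integers $\ge2$ with maximum element $L$, and let $\mathcal H=\bigcup_{\ell\in\mathbb L}\mathcal H_\ell$ be an inhomogeneous non-uniform Erdős–Rényi hypergraph on $[N]$ in which an $\ell$-subset $\{i_1,\dots,i_\ell\}$ is a hyperedge with probability $d_{i_1,\dots,i_\ell}/\binom{N-1}{\ell-1}$. Put $d_\ell:=\max d_{i_1,\dots,i_\ell}$ (maximum over $\ell$-subsets) and suppose that, for some constant $c>0$, $$d:=\sum_{\ell\in\mathbb L}(\ell-1)d_\ell\ \ge\ c\log N .$$ Let $A$ be the adjacency matrix of $\mathcal H$. Then for any $\theta>0$, with $$C:=512\,L(L-1)(\theta+6)\Big[2+\frac{(L-1)(1+\theta)}{c}\Big],$$ one has, with probability at least $1-2N^{-\theta}-2e^{-N}$, $$\|A-\mathbb E A\|\le C\sqrt d .$$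
   Context: Inhomogeneous Erdős–Rényi hypergraph: for each $\ell\in\mathbb L$ let $Q^{(\ell)}$ be a symmetric tensor of order $\ell$ on $[N]$ with entries in $[0,1]$; here $Q^{(\ell)}_{i_1,\dots,i_\ell}=d_{i_1,\dots,i_\ell}/\binom{N-1}{\ell-1}$. In $\mathcal H_\ell$ each set $e=\{i_1,\dots,i_\ell\}$ of $\ell$ distinct vertices is a hyperedge with probability $Q^{(\ell)}_{i_1,\dots,i_\ell}$, all independently (over all $e$ and all $\ell\in\mathbb L$); $\mathcal H=\bigcup_{\ell\in\mathbb L}\mathcal H_\ell$. Adjacency matrix: $A$ is the $N\times N$ symmetric matrix with $A_{ii}=0$ and, for $i\ne j$, $A_{ij}$ = the number of hyperedges of $\mathcal H$ (of all sizes $\ell\in\mathbb L$) containing both $i$ and $j$. $\|\cdot\|$ is the spectral norm. *)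

(* Defs.v *)
From mathcomp Require Import all_boot all_order all_algebra.
From mathcomp Require Import finmap.
From mathcomp Require Import all_classical all_reals all_analysis.

Set Implicit Arguments.
Unset Strict Implicit.
Unset Printing Implicit Defensive.

Import Order.TTheory GRing.Theory Num.Theory.
Local Open Scope classical_set_scope.
Local Open Scope ring_scope.

Section SpectralNorm.
Context {R : realType} {n : nat}.

Definition l2norm (x : 'cV[R]_n) : R := Num.sqrt (\sum_(i < n) x i 0 ^+ 2).

Definition spectral_norm (M : 'M[R]_n) : R :=
  sup [set l2norm (M *m x) | x in [set x : 'cV[R]_n | l2norm x <= 1]].

End SpectralNorm.

Section Tensors.
Context {R : realType} {N : nat}.

Definition tensor (l : nat) : Type := l.-tuple 'I_N -> R.

Definition symmetric_tensor (l : nat) (q : tensor l) : Prop :=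
  forall s t : l.-tuple 'I_N, perm_eq s t -> q s = q t.

(* Maximum of q over the l-subsets of the index set, i.e. over tuples of
   distinct indices; the value is 0 if there are none (N < l).  The default 0
   does not affect the maximum of a nonnegative tensor. *)
Definition max_entry (l : nat) (q : tensor l) : R :=
  \big[Num.max/0]_(t : l.-tuple 'I_N | uniq t) q t.

(* For N < l the binomial vanishes and, since x / 0 = 0, so does the tensor;
   there is then no l-subset of vertices. *)
Definition edge_probability (d : forall l : nat, tensor l) (l : nat) : tensor l :=
  fun t => d l t / 'C(N.-1, l.-1)%:R.

End Tensors.
Arguments tensor : clear implicits.

(* Mutual independence of the events E i, i \in D. *)
Definition independent_events (disp : measure_display)
    (T : measurableType disp) (R : realType) (P : probability T R)
    (I : finType) (D : {set I}) (E : I -> set T) : Prop :=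
  (forall i, i \in D -> measurable (E i)) /\
  (forall F : {set I}, F \subset D ->
     P (\bigcap_(i in [set` F]) E i) = (\prod_(i in F) P (E i))%E).

(* A hypergraph on 'I_N is its set of hyperedges; H_l is recovered from H as
   its set of hyperedges of cardinality l.  Only the entries of Q l at tuples
   of distinct indices affect the law of H. *)
Definition erdos_renyi_hypergraph (disp : measure_display)
    (T : measurableType disp) (R : realType) (P : probability T R) (N : nat)
    (LL : {fset nat}) (Q : forall l : nat, tensor R N l)
    (H : T -> {set {set 'I_N}}) : Prop :=
  [/\ forall l, l \in LL ->
        symmetric_tensor (Q l) /\ (forall t, 0 <= Q l t <= 1),
      forall w e, e \in H w -> #|e| \in LL,
      forall l (t : l.-tuple 'I_N), l \in LL -> uniq t ->
        P [set w | [set i in t]%SET \in H w] = (Q l t)%:E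
    & independent_events P [set e : {set 'I_N} | #|e| \in LL]%SET
        (fun e => [set w | e \in H w])].

Definition adjacency (R : realType) (N : nat) (G : {set {set 'I_N}}) : 'M[R]_N :=
  \matrix_(i, j)
    if i == j then 0 else #|[set e in G | (i \in e) && (j \in e)]%SET|%:R.

Definition expected_adjacency (disp : measure_display)
    (T : measurableType disp) (R : realType) (P : probability T R) (N : nat)
    (H : T -> {set {set 'I_N}}) : 'M[R]_N :=
  \matrix_(i, j) fine ('E_P[fun w => adjacency R (H w) i j])%E.

(* Main.v *)
(** The Kahn-Szemeredi argument.  Rounding unit vectors to a lattice reduces the
    norm of [M = A - E A] to the bilinear forms [sum z_i y_j M_ij] over a net of
    [exp (O(N))] pairs of integer vectors.

    Light pairs, [|z_i y_j| <= sqrt d], contribute a sum of independent terms of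
    size at most [L (L - 1) sqrt d], and Bernstein's inequality survives the
    union bound over the net.

    Heavy pairs contribute little in mean.  For the adjacency part, pairs with
    [|z_i| / |y_j|] outside [8 / sqrt d, sqrt d / 8] are controlled by the
    degrees.  The others are grouped into dyadic level sets [S_a] and [T_b], and
    Chernoff's inequality gives simultaneously, for all [S], [T] and [r >= e] in
    a short list, the discrepancy bound
      [e(S, T) <= r (2 d / N) |S| |T| + K (g(S) + g(T)) / ln r]
    with [g(S) = |S| (1 + ln (N / |S|))], [K = L (L - 1) (theta + 6)].  Taking
    [r = e 2^(a + b + 2) / sqrt d] makes both terms summable over the levels. *)
Require Import Defs.
From mathcomp Require Import all_boot all_order all_algebra.
From mathcomp Require Import finmap.
From mathcomp Require Import all_classical all_reals all_analysis.
From mathcomp Require Import zify ring lra.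
Import Order.TTheory GRing.Theory Num.Theory.
Local Open Scope classical_set_scope.
Local Open Scope ring_scope.

(** * Elementary real inequalities *)

Section Inequalities.
Context {R : realType}.
Implicit Types u v x y s t U W q : R.

(** From [1 - u <= exp (- u)] one gets [exp u <= 1 / (1 - u)], and [(1 - u) (1 + u + 2 u^2) = 1 +
    u^2 (1 - 2 u)]. Arbitrarily negative [u] are allowed, as one-sided tails require. *)
Lemma expR_ub_quadratic u : u <= 1 / 2 -> expR u <= 1 + u + 2 * u ^+ 2.
Proof.
move=> hu; have h := expR_ge1Dx (- u).
have h1 : 0 < 1 - u by lra.
have h2 : expR u <= (1 - u)^-1.
  by rewrite -(invrK (expR u)) -expRN lef_pV2 ?posrE ?expR_gt0.
apply: (le_trans h2); rewrite -[leLHS]mul1r ler_pdivrMr//; nra.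
Qed.

Lemma expR1_le3 : expR 1 <= 3 :> R.
Proof.
(* [exp (1/6) <= 1 / (1 - 1/6) = 6/5], and [(6/5)^6 = 2.985984]. *)
have h : expR (6%:R^-1) <= 6 / 5 :> R.
  have h := expR_ge1Dx (- (6%:R^-1) : R).
  rewrite -(invrK (expR _)) -expRN -(invrK (6 / 5)) lef_pV2 ?posrE ?expR_gt0//; lra.
have -> : 1 = 6%:R * 6%:R^-1 :> R by rewrite divff.
rewrite expRM_natl; apply: (@le_trans _ _ ((6 / 5) ^+ 6)); last by lra.
by rewrite lerXn2r ?nnegrE ?expR_ge0//; lra.
Qed.

(** Convexity of [exp] on the segment from [0] to [s]. The Chernoff arguments use it to bound an
    exponential linearly in a quantity normalized to [[0, 1]]. *)
Lemma expR_chord t s : 0 <= t <= 1 -> expR (t * s) <= 1 + t * (expR s - 1).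
Proof.
move=> /andP[t0 t1].
have ht : 0 <= (1 - t) <= 1 by lra.
have := convex_expR (Itv01 t0 t1) (s : R^o) (0 : R^o).
by rewrite !convRE /= mulr0 addr0 expR0 mulr1 /unstable.onem; lra.
Qed.

Lemma ln_leB1 x : 0 < x -> ln x <= x - 1.
Proof. by move=> x0; have := @le_ln1Dx R (x - 1); rewrite subrKC; apply; lra. Qed.

Lemma ln_le_sqrt v : 0 < v -> 1 + ln v <= 2 * Num.sqrt v.
Proof.
move=> v0; have s0 : 0 < Num.sqrt v by rewrite sqrtr_gt0.
have := ln_leB1 _ s0.
rewrite -{3}(sqr_sqrtr (ltW v0)) lnXn// mulr2n; lra.
Qed.

(** With [x = U / u >= 1], [1 + ln U <= (1 + ln u) (1 + ln x) <= (1 + ln u) 2 sqrt x]. The bound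
    depends on [u] only through [sqrt u], hence sums geometrically over dyadic [u]. *)
Lemma div_ln_le u U : 1 < u -> u <= U ->
  u / (1 + ln u) <= 2 * Num.sqrt u * Num.sqrt U / (1 + ln U).
Proof.
move=> u1 uU; have u0 : 0 < u by lra.
have U0 : 0 < U by lra.
have lu : 0 < ln u by rewrite ln_gt0.
have lU : 0 < ln U by rewrite ln_gt0; lra.
rewrite ler_pdivrMr; last by lra.
rewrite mulrAC ler_pdivlMr; last by lra.
have v0 : 0 < U / u by rewrite divr_gt0.
have lv : ln U = ln u + ln (U / u) by rewrite ln_div ?posrE//; lra.
have v1 : 0 <= ln (U / u) by rewrite ln_ge0// ler_pdivlMr// mul1r.
have h := ln_le_sqrt _ v0.
have su : Num.sqrt u ^+ 2 = u by rewrite sqr_sqrtr// ltW.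
have s0 : 0 < Num.sqrt u by rewrite sqrtr_gt0.
have sv : Num.sqrt U = Num.sqrt u * Num.sqrt (U / u).
  by rewrite -sqrtrM ?ltW// mulrCA divff ?mulr1// gt_eqF.
have -> : 2 * Num.sqrt u * Num.sqrt U * (1 + ln u)
   = u * ((2 * Num.sqrt (U / u)) * (1 + ln u)).
  rewrite sv -[X in _ = X * _]su; ring.
rewrite ler_pM2l// lv.
have h2 : (1 + ln (U / u)) * (1 + ln u) <= 2 * Num.sqrt (U / u) * (1 + ln u).
  by rewrite ler_pM2r//; lra.
apply: le_trans h2; nra.
Qed.

(** If the largest index passes the cutoff, then all do, and the full geometric sum is controlled by
    its top term, itself at most [W]. *)
Lemma truncated_geometric_sum n q v W : 1 < q -> 0 < v -> 0 <= W ->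
  (q - 1) * \sum_(a < n | q ^+ a * v <= W) q ^+ a * v <= q * W.
Proof.
move=> q1 v0 W0; elim: n => [|n IH].
  by rewrite big_ord0 mulr0 mulr_ge0//; lra.
have [h|h] := leP (q ^+ n * v) W; last first.
  rewrite big_mkcond big_ord_recr /= (lt_geF h) addr0 -big_mkcond; exact: IH.
rewrite (_ : \sum_(_ < _ | _) _ = \sum_(a < n.+1) q ^+ a * v); last first.
  apply: eq_bigl => a; apply: le_trans h; rewrite ler_pM2r// ler_eXn2l//.
  by rewrite -ltnS.
rewrite -mulr_suml mulrA -subrX1 exprS mulrBl mul1r -mulrA.
apply: (@le_trans _ _ (q * (q ^+ n * v))); first by lra.
by rewrite ler_pM2l//; lra.
Qed.

(** The sum of the squares [(B a_i - C b_i)^2] equals [B (A B - C^2)]. If [B = 0], every [b_i]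
    vanishes. *)
Lemma cauchy_schwarz_sum (I : finType) (P : pred I) (a b : I -> R) :
  (\sum_(i | P i) a i * b i) ^+ 2
    <= (\sum_(i | P i) a i ^+ 2) * (\sum_(i | P i) b i ^+ 2).
Proof.
set A := \sum_(i | P i) a i ^+ 2; set B := \sum_(i | P i) b i ^+ 2.
set C := \sum_(i | P i) a i * b i.
have B0 : 0 <= B by apply: sumr_ge0 => i _; exact: sqr_ge0.
have [B00|Bn0] := eqVneq B 0.
  suff -> : C = 0 by rewrite expr0n /= B00 mulr0.
  apply: big1 => i Pi; have := psumr_eq0P (fun i _ => sqr_ge0 (b i)) B00 Pi.
  by move/eqP; rewrite sqrf_eq0 => /eqP ->; rewrite mulr0.
have : 0 <= \sum_(i | P i) (B * a i - C * b i) ^+ 2.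
  by apply: sumr_ge0 => i _; exact: sqr_ge0.
have -> : \sum_(i | P i) (B * a i - C * b i) ^+ 2 = B * (A * B - C ^+ 2).
  rewrite (eq_bigr (fun i => B ^+ 2 * a i ^+ 2 - 2 * B * C * (a i * b i)
     + C ^+ 2 * b i ^+ 2)); last by move=> i _; ring.
  by rewrite big_split sumrB -!mulr_sumr -/A -/B -/C /=; ring.
by rewrite pmulr_rge0 ?subr_ge0// lt0r Bn0.
Qed.

Lemma sqr_sum_le_card (I : finType) (P : pred I) (a : I -> R) :
  (\sum_(i | P i) a i) ^+ 2 <= #|P|%:R * \sum_(i | P i) a i ^+ 2.
Proof.
have := cauchy_schwarz_sum I P a (fun=> 1).
rewrite (eq_bigr a) => [|i _]; last by rewrite mulr1.
by under [X in _ * X]eq_bigr do rewrite expr1n; rewrite sumr_const mulrC.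
Qed.

End Inequalities.

(** * Finite random sets with independent inclusions *)

Section RandomSubset.
Context {R : realType} {I : finType} {p : I -> R} {law : {set I} -> R}.
Context (p01 : forall e, 0 <= p e <= 1) (law_ge0 : forall G, 0 <= law G).
Context (law_incl : forall F : {set I},
  \sum_(G : {set I} | F \subset G) law G = \prod_(e in F) p e).

(* Expanding the product over [e \in G] of [1 + (x e - 1)] reduces the moment
   generating function to the inclusion probabilities. *)
Lemma law_prod (x : I -> R) :
  \sum_(G : {set I}) law G * \prod_(e in G) x e
    = \prod_(e : I) (1 + (x e - 1) * p e).
Proof.
have expand (G : {set I}) : \prod_(e in G) x e
    = \sum_(F : {set I} | F \subset G) \prod_(e in F) (x e - 1).
  rewrite big_mkcond.
  rewrite (eq_bigr (fun e => (if e \in G then x e - 1 else 0) + 1)); last first.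
    by move=> e _; case: ifP => _; [rewrite subrK | rewrite add0r].
  rewrite (@bigA_distr _ 0 1 (GRing.mul : Monoid.mul_law 0) (+%R)).
  rewrite [RHS]big_mkcond; apply: eq_big => // F _.
  rewrite -big_mkcond /=.
  case: ifPn => [/fintype.subsetP FG|/fintype.subsetPn[e eF eG]].
    by apply: eq_bigr => e /FG ->.
  by rewrite (bigD1 e)//= (negbTE eG) mul0r.
under [LHS]eq_bigr do rewrite expand mulr_sumr big_mkcond.
rewrite exchange_big /=.
transitivity (\sum_(F : {set I}) \prod_(e in F) ((x e - 1) * p e)).
  apply: eq_bigr => F _; rewrite big_split /= -law_incl mulr_sumr.
  rewrite [RHS]big_mkcond; apply: eq_bigr => G _.
  by case: ifP; rewrite // mulrC.
under [RHS]eq_bigr do rewrite addrC.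
rewrite (@bigA_distr _ 0 1 (GRing.mul : Monoid.mul_law 0) (+%R)).
by apply: eq_big => // F _; rewrite [LHS]big_mkcond.
Qed.

Lemma law_total : \sum_(G : {set I}) law G = 1.
Proof.
have := law_incl finset.set0; rewrite big_set0 => <-.
by apply: eq_bigl => G; rewrite finset.sub0set.
Qed.

(** [1 + u <= exp u], applied to each factor of [law_prod]. *)
Lemma law_mgf (a : I -> R) :
  \sum_(G : {set I}) law G * expR (\sum_(e in G) a e)
    <= expR (\sum_e p e * (expR (a e) - 1)).
Proof.
under eq_bigr do rewrite expR_sum.
rewrite law_prod expR_sum; apply: ler_prod => e _; apply/andP; split.
  by have := p01 e; have := expR_ge0 (a e); nra.
by rewrite mulrC; exact: expR_ge1Dx.
Qed.

(** Markov's inequality for the exponential of the sum; the usual free parameter is absorbed into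
    [a] and [tau]. *)
Lemma chernoff (a : I -> R) (tau : R) :
  \sum_(G : {set I} | tau <= \sum_(e in G) a e) law G
    <= expR (\sum_e p e * (expR (a e) - 1) - tau).
Proof.
rewrite expRD.
apply: (@le_trans _ _ ((\sum_(G : {set I}) law G * expR (\sum_(e in G) a e))
  * expR (- tau))); last by rewrite ler_wpM2r ?expR_ge0// law_mgf.
rewrite mulr_suml [leLHS]big_mkcond; apply: ler_sum => G _.
rewrite -mulrA -expRD; case: ifP => [h|_]; last first.
  by rewrite mulr_ge0 ?expR_ge0.
by rewrite ler_peMr//; have := expR_ge1Dx (\sum_(e in G) a e - tau); lra.
Qed.

(** The quadratic bound on [exp] cancels the mean and leaves twice the second moment. The size
    condition concerns only [p e != 0], because vertex sets of inadmissible size have weight zero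
    but possibly large forms. *)
Lemma bernstein (a : I -> R) (tau : R) :
  (forall e, p e != 0 -> a e <= 1 / 2) ->
  \sum_(G : {set I} | tau <= \sum_(e in G) a e - \sum_e p e * a e) law G
    <= expR (2 * (\sum_e p e * a e ^+ 2) - tau).
Proof.
move=> ha; under eq_bigl do rewrite lerBrDr.
apply: (le_trans (chernoff a _)); rewrite ler_expR.
rewrite opprD addrCA addrA -subr_le0 [X in X - _]addrC addrA opprD opprK addrA.
suff : \sum_e p e * (expR (a e) - 1) <=
   2 * (\sum_e p e * a e ^+ 2) + \sum_e p e * a e by lra.
rewrite mulr_sumr -big_split; apply: ler_sum => e _ /=.
have [->|pe] := eqVneq (p e) 0; first by rewrite !mul0r mulr0 addr0.
rewrite mulrCA -mulrDr; have /andP[p0 _] := p01 e; rewrite ler_wpM2l//.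
by have := expR_ub_quadratic _ (ha _ pe); lra.
Qed.

Lemma union_bound (J : finType) (P : pred J) (B : J -> pred {set I}) :
  \sum_(G : {set I} | [exists j, P j && B j G]) law G
    <= \sum_(j | P j) \sum_(G : {set I} | B j G) law G.
Proof.
under [leRHS]eq_bigr do rewrite big_mkcond.
rewrite exchange_big /= [leLHS]big_mkcond; apply: ler_sum => G _.
case: ifPn => [/existsP[j /andP[Pj Bj]]|_]; last first.
  by apply: sumr_ge0 => j _; case: ifP.
rewrite (bigD1 j)//= Bj lerDl; apply: sumr_ge0 => k _; by case: ifP.
Qed.

End RandomSubset.

(** * From a probability space to the finite law of a random set *)

Section RandomSubsetLaw.
Context {R : realType} {disp : measure_display} {T : measurableType disp}
  {P : probability T R} {I : finType}.
Implicit Types (D G F : {set I}) (H : T -> {set I}).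

Definition law_of H G : R := fine (P [set w | H w = G]).

Definition inclusion_proba H (e : I) : R := fine (P [set w | e \in H w]).

Context {D : {set I}} {H : T -> {set I}}.
Context (HD : forall w e, e \in H w -> e \in D).
Context (Hind : independent_events P D (fun e => [set w | e \in H w])).

Lemma inclusion_notin e : e \notin D -> [set w | e \in H w] = set0.
Proof. by move=> eD; apply/seteqP; split => w //= /HD eDw; rewrite eDw in eD. Qed.

Lemma measurable_inclusion e : measurable [set w | e \in H w].
Proof.
have [eD|eD] := boolP (e \in D); first exact: (Hind.1 e eD).
by rewrite inclusion_notin.
Qed.

(** There are finitely many values [G], and each fibre [H w = G] is a finite intersection of
    inclusion events and complements of such events. *)
Lemma measurable_preimage_set (Q : pred {set I}) : measurable [set w | Q (H w)].
Proof.
have mG G : measurable [set w | H w = G].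
  have -> : [set w | H w = G]
      = \bigcap_(e in [set: I]) (if e \in G then [set w | e \in H w]
                                 else ~` [set w | e \in H w]).
    apply/seteqP; split => w /= hw.
      by move=> e _; case: ifPn; rewrite -hw // => /negP.
    apply/finset.setP => e; have := hw e Logic.I.
    by case: ifP => _ //= /negP/negbTE.
  apply: fin_bigcap_measurable; first exact: finite_finset.
  move=> e _; case: ifP => _; last apply: measurableC;
    exact: measurable_inclusion.
have -> : [set w | Q (H w)] = \bigcup_(G in [set` Q]) [set w | H w = G].
  apply/seteqP; split => w /= => [QH|[G QG ->//]].
  by exists (H w).
by apply: fin_bigcup_measurable => //; exact: finite_finset.
Qed.

Lemma law_of_ge0 G : 0 <= law_of H G.
Proof. by rewrite fine_ge0. Qed.

Lemma inclusion_proba01 e : 0 <= inclusion_proba H e <= 1.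
Proof.
rewrite fine_ge0//= -lee_fin fineK; last first.
  exact/fin_num_measure/measurable_inclusion.
exact/probability_le1/measurable_inclusion.
Qed.

Lemma proba_law (Q : pred {set I}) :
  P [set w | Q (H w)] = (\sum_(G | Q G) law_of H G)%:E.
Proof.
have mG G : measurable [set w | H w = G].
  rewrite (_ : [set w | _] = [set w | pred1 G (H w)]); last first.
    by apply/seteqP; split => w /= /eqP.
  exact: measurable_preimage_set.
have -> : [set w | Q (H w)] = \bigcup_(G in [set` Q]) [set w | H w = G].
  apply/seteqP; split => w /= => [QH|[G QG ->//]].
  by exists (H w).
have tH : trivIset [set` Q] (fun G => [set w | H w = G]).
  by move=> G G' _ _ [w [/= -> ->]].
rewrite (measure_fin_bigcup P finite_finset tH (fun G _ => mG G)).
rewrite -(@bigfs _ _ _ _ (index_enum {set I})) ?index_enum_uniq//; last first.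
  by move=> G _; rewrite mem_index_enum.
rewrite -sumEFin; apply: eq_bigr => G _; rewrite fineK//.
exact: fin_num_measure.
Qed.

(** Independence gives the product when [F] lies in [D]; otherwise both sides vanish, an element
    outside [D] being never included. *)
Lemma law_of_incl F :
  \sum_(G : {set I} | F \subset G) law_of H G
    = \prod_(e in F) inclusion_proba H e.
Proof.
apply: EFin_inj; rewrite -(proba_law (fun G => F \subset G)).
have [FD|/fintype.subsetPn[e eF eD]] := boolP (F \subset D).
  transitivity (P (\bigcap_(i in [set` F]) [set w | i \in H w])).
    congr (P _); apply/seteqP; split => w /= => [/fintype.subsetP FH e /FH//|FH].
    by apply/fintype.subsetP => e /FH.
  rewrite (Hind.2 F FD) -prodEFin; apply: eq_bigr => e _.
  by rewrite fineK//; exact/fin_num_measure/measurable_inclusion.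
rewrite (bigD1 e)//= /inclusion_proba inclusion_notin// measure0 mul0r.
rewrite (_ : [set w | _] = set0) ?measure0//.
apply/seteqP; split => w //= /fintype.subsetP/(_ e eF) /HD eDw.
by rewrite eDw in eD.
Qed.

(** The cardinality is a sum of indicators of inclusion events, and expectation is additive. *)
Lemma expectation_card (Q : pred I) :
  ('E_P[fun w => #|[set e in H w | Q e]%SET|%:R]
    = (\sum_(e | Q e) inclusion_proba H e)%:E)%E.
Proof.
rewrite unlock.
under eq_integral => w _.
  have -> : (#|[set e in H w | Q e]%SET|%:R%:E : \bar R)
      = (\sum_(e <- [seq e <- index_enum I | Q e])
           (\1_[set w | e \in H w] w)%:E)%E.
    rewrite sumEFin; congr EFin; rewrite big_filter -sum1_card natr_sum.
    rewrite big_mkcond [RHS]big_mkcond; apply: eq_bigr => e _.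
    rewrite inE indicE; case: (Q e); rewrite ?andbT ?andbF//.
    by case: ifPn => eH; [rewrite mem_set | rewrite memNset//; exact/negP].
  over.
rewrite ge0_integral_sum//; last 1 first.
  move=> e; apply/measurable_realfun.measurable_EFinP.
  apply: measurable_realfun.measurable_indic.
  exact: measurable_inclusion.
rewrite big_filter -sumEFin; apply: eq_bigr => e _.
rewrite integral_indic ?setIT ?fineK//; last exact: measurable_inclusion.
exact/fin_num_measure/measurable_inclusion.
Qed.

End RandomSubsetLaw.

(** * Reduction of the spectral norm to a lattice net *)

Section LatticeNet.
Context {R : realType} {N : nat}.

(* An integer vector, stored coordinatewise as an absolute value and a sign;
   the net of the unit ball consists of the vectors [coord z / (2 sqrt N)]. *)
Definition lattice_point := {ffun 'I_N -> 'I_(4 * N).+1 * bool}.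

Implicit Types z w : lattice_point.

Definition coord z (i : 'I_N) : R := (-1) ^+ (z i).2 * (z i).1%:R.

Definition in_net z := (\sum_i (z i).1 ^ 2 <= 4 * N)%N.

Lemma coord_sqr z i : coord z i ^+ 2 = ((z i).1 ^ 2)%N%:R.
Proof. by rewrite /coord exprMn sqrr_sign mul1r natrX. Qed.

Lemma sum_coord_sqr z : in_net z -> \sum_i coord z i ^+ 2 <= 4 * N%:R.
Proof.
move=> hz; under eq_bigr do rewrite coord_sqr.
by rewrite -natr_sum -natrM ler_nat.
Qed.

(** Rounding towards zero: absolute values do not grow, so a rounded vector stays in the ball. *)
Lemma round_coord (y : R) : exists (k : nat) (b : bool),
  `|y - (-1) ^+ b * k%:R| <= 1 /\ k%:R <= `|y|.
Proof.
exists (Num.truncn `|y|), (y < 0).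
have /andP[h1 h2] := truncn_itv (normr_ge0 y).
rewrite -natr1 in h2; split=> //.
have [y0|y0] := ltP y 0.
  by rewrite ltr0_norm// in h1 h2 *; rewrite expr1 ler_norml; lra.
by rewrite ger0_norm// in h1 h2 *; rewrite expr0 ler_norml; lra.
Qed.

Lemma exists_rounding (y : 'I_N -> R) : \sum_i y i ^+ 2 <= 4 * N%:R ->
  exists2 z, in_net z & forall i, `|y i - coord z i| <= 1.
Proof.
move=> hy.
have /choice[k hk] : forall i, exists kb : nat * bool,
    `|y i - (-1) ^+ kb.2 * kb.1%:R| <= 1 /\ kb.1%:R <= `|y i|.
  by move=> i; have [k [b h]] := round_coord (y i); exists (k, b).
have sumk : (\sum_i (k i).1 ^ 2 <= 4 * N)%N.
  rewrite -(ler_nat R) natrM; apply: le_trans hy; rewrite natr_sum.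
  apply: ler_sum => i _; rewrite natrX -[leRHS]real_normK ?num_real//.
  by rewrite lerXn2r ?nnegrE//; have [] := hk i.
(* The absolute value fits in the ordinal type, since [k <= k^2 <= 4 N] for an integer [k]. *)
have kN i : ((k i).1 < (4 * N).+1)%N.
  rewrite ltnS; apply: leq_trans sumk; rewrite (bigD1 i)//=.
  by apply: leq_trans (leq_addr _ _); case: (k i).1 => // n; rewrite leq_pmulr.
exists [ffun i => (Ordinal (kN i), (k i).2)].
  by rewrite /in_net; under eq_bigr do rewrite ffunE.
by move=> i; rewrite /coord ffunE /=; have [] := hk i.
Qed.

(** Round the vector [y] of norm [2 sqrt N] in the direction of [v] to a net point [z]. Each
    coordinate moves by at most 1, so [y - z] has norm at most [sqrt N], and pairing with [v] still
    leaves [2 sqrt N |v| - sqrt N |v|]. *)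
Lemma net_duality (v : 'I_N -> R) (b : R) :
  (forall z, in_net z -> \sum_i v i * coord z i <= b) ->
  Num.sqrt N%:R * Num.sqrt (\sum_i v i ^+ 2) <= b.
Proof.
move=> hb; set s := Num.sqrt (\sum_i _); set r := Num.sqrt N%:R.
have V0 : 0 <= \sum_i v i ^+ 2 by apply: sumr_ge0 => i _; exact: sqr_ge0.
have s2 : s ^+ 2 = \sum_i v i ^+ 2 by rewrite sqr_sqrtr.
have r2 : r ^+ 2 = N%:R by rewrite sqr_sqrtr.
have r0 : 0 <= r by rewrite sqrtr_ge0.
have := sqrtr_ge0 (\sum_i v i ^+ 2); rewrite -/s le_eqVlt => /predU1P[s0|s0].
  (* For [v = 0] it remains to see [0 <= b], which any net point provides. *)
  have [|z hz _] := exists_rounding (fun=> 0).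
    by rewrite big1 ?mulr_ge0// => i _; rewrite expr0n.
  rewrite -s0 mulr0; apply: le_trans (hb _ hz); rewrite big1// => i _.
  have := psumr_eq0P (fun i _ => sqr_ge0 (v i)) _ (i := i) isT.
  rewrite -s2 -s0 expr0n => /(_ erefl)/eqP; rewrite sqrf_eq0 => /eqP ->.
  by rewrite mul0r.
pose y i := 2 * r / s * v i.
have hy : \sum_i y i ^+ 2 = 4 * N%:R.
  under eq_bigr do rewrite exprMn.
  by rewrite -mulr_sumr -s2 -r2; field; rewrite gt_eqF.
have [|z hz hzy] := exists_rounding y; first by rewrite hy.
have hvy : \sum_i v i * y i = 2 * r * s.
  under eq_bigr do rewrite mulrCA -expr2.
  by rewrite -mulr_sumr -s2; field; rewrite gt_eqF.
have hd : \sum_i v i * (y i - coord z i) <= s * r.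
  rewrite (le_trans (ler_norm _))// -(@ler_pXn2r _ 2)// ?nnegrE ?mulr_ge0 ?(ltW s0)//.
  rewrite real_normK ?num_real// exprMn s2 r2.
  apply: (le_trans (cauchy_schwarz_sum _ _ _ _)); rewrite ler_wpM2l//.
  rewrite -[N in leRHS]card_ord -sumr_const; apply: ler_sum => i _.
  by rewrite -real_normK ?num_real// expr_le1.
have : \sum_i v i * (y i - coord z i)
    = \sum_i v i * y i - \sum_i v i * coord z i.
  by rewrite -sumrB; apply: eq_bigr => i _; rewrite mulrBr.
by have := hb _ hz; lra.
Qed.

(** Duality is used twice: on the vector [M x], then on the row vector [z M]. In between,
    Cauchy-Schwarz removes [x] from the unit ball. *)
Lemma spectral_norm_le_net (M : 'M[R]_N) (b : R) : (0 < N)%N ->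
  (forall z w, in_net z -> in_net w ->
     \sum_i \sum_j coord z i * coord w j * M i j <= b * N%:R) ->
  spectral_norm M <= b.
Proof.
move=> N0 hb; set r := Num.sqrt (N%:R : R).
have r0 : 0 < r by rewrite sqrtr_gt0 ltr0n.
have r2 : N%:R = r * r by rewrite -expr2 sqr_sqrtr.
apply: ge_sup.
  exists (l2norm (M *m 0)); exists 0 => //=.
  by rewrite /l2norm big1 ?sqrtr0// => i _; rewrite mxE expr0n.
move=> _ [x /= hx <-].
rewrite -(ler_pM2l r0); apply: net_duality => z hz.
have hv : Num.sqrt (\sum_j (\sum_i coord z i * M i j) ^+ 2) <= b * r.
  rewrite -(ler_pM2l r0) mulrCA -r2; apply: net_duality => w hw.
  apply: le_trans (hb _ _ hz hw); rewrite exchange_big /=.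
  apply: ler_sum => j _; rewrite mulr_suml; apply: ler_sum => i _.
  by rewrite mulrAC.
rewrite mulrC; apply: le_trans hv.
have -> : \sum_i (M *m x) i 0 * coord z i
    = \sum_j (\sum_i coord z i * M i j) * x j 0.
  under eq_bigr do rewrite mxE mulr_suml.
  rewrite exchange_big; apply: eq_bigr => j _; rewrite mulr_suml.
  by apply: eq_bigr => i _; rewrite mulrAC (mulrC (M i j)).
apply: (le_trans (ler_norm _)).
rewrite -(@ler_pXn2r _ 2)// ?nnegrE ?sqrtr_ge0// real_normK ?num_real//.
rewrite sqr_sqrtr; last by apply: sumr_ge0 => j _; exact: sqr_ge0.
apply: (le_trans (cauchy_schwarz_sum _ _ _ _)); rewrite ler_piMr//.
  by apply: sumr_ge0 => j _; exact: sqr_ge0.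
rewrite -[leLHS]sqr_sqrtr; last by apply: sumr_ge0 => j _; exact: sqr_ge0.
by rewrite expr_le1 ?sqrtr_ge0.
Qed.

(* [z i <= z i ^ 2] in absolute values, so the weight of a point of the net is
   at least 1, while the total weight factorizes. *)
Lemma card_net : #|[pred z | in_net z]|%:R <= 64%:R ^+ N :> R.
Proof.
pose f (kb : 'I_(4 * N).+1 * bool) : R := 16%:R * 2^-1 ^+ kb.1.
have f0 kb : 0 <= f kb by rewrite mulr_ge0// exprn_ge0// invr_ge0.
rewrite -sum1_card natr_sum.
apply: (@le_trans _ _ (\sum_(z : lattice_point) \prod_i f (z i))).
  rewrite big_mkcond; apply: ler_sum => z _.
  case: ifPn => hz; last by apply: prodr_ge0 => i _.
  rewrite big_split /= prodr_const card_ord prodrXr exprVn.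
  rewrite ler_pdivlMr ?exprn_gt0// mul1r.
  rewrite (_ : 16%:R = 2 ^+ 4) -?exprM; last by ring.
  rewrite ler_weXn2l ?ler1n//; apply: leq_trans hz.
  by apply: leq_sum => i _; case: (nat_of_ord _) => // n; rewrite leq_pmulr.
rewrite -(bigA_distr_bigA (fun=> f)) prodr_const card_ord.
rewrite lerXn2r ?nnegrE ?sumr_ge0//.
rewrite -(pair_bigA _ (fun k b => f (k, b)))/=.
(* Two signs and a geometric series of sum at most 2 give [16 * 2 * 2 = 64] per coordinate. *)
under eq_bigr do rewrite big_bool /f /= -mulr2n.
have h n : \sum_(k < n) 2^-1 ^+ k <= 2 - 2 * 2^-1 ^+ n :> R.
  elim: n => [|n IH]; first by rewrite big_ord0 expr0; lra.
  by rewrite big_ord_recr /= exprS; lra.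
rewrite sumrMnl -mulr_sumr.
have := h (4 * N).+1; have : 0 <= 2^-1 ^+ (4 * N).+1 :> R.
  by rewrite exprn_ge0// invr_ge0.
by rewrite mulr2n; lra.
Qed.

End LatticeNet.

(** * Heavy pairs *)

Section DyadicSums.
Context {R : realType}.

(** Equivalent to [4 <= 3 sqrt 2]. It bounds by 4 the constant [q / (q - 1)] of a geometric sum of
    ratio [q = sqrt 2]. *)
Lemma sqrt2_ratio : Num.sqrt 2 <= 4 * (Num.sqrt 2 - 1) :> R.
Proof.
have h := sqr_sqrtr (ler0n R 2); have h0 := sqrtr_ge0 (2 : R).
by nra.
Qed.

(** By [div_ln_le] the terms are at most [2 sqrt u sqrt U / (1 + ln U)], where [sqrt u] runs through
    a progression of ratio [sqrt 2] cut at [sqrt U], of sum at most [4 sqrt U]. *)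
Lemma dyadic_div_ln_sum n (v U : R) : 0 < v -> 1 <= U ->
  \sum_(a < n | 1 < 2 ^+ a * v <= U) 2 ^+ a * v / (1 + ln (2 ^+ a * v))
    <= 8 * U / (1 + ln U).
Proof.
move=> v0 U1; have U0 : 0 < U by lra.
have lU : 0 <= ln U by rewrite ln_ge0.
have h2 : 1 < Num.sqrt 2 :> R by rewrite -{1}sqrtr1 ltr_sqrt//; lra.
have W0 : 0 <= Num.sqrt U by exact: sqrtr_ge0.
have v0' : 0 < Num.sqrt v by rewrite sqrtr_gt0.
have sq a : Num.sqrt (2 ^+ a * v) = Num.sqrt 2 ^+ a * Num.sqrt v.
  rewrite sqrtrM ?exprn_ge0// -{1}(sqr_sqrtr (ler0n R 2)) exprAC sqrtr_sqr.
  by rewrite ger0_norm// exprn_ge0// sqrtr_ge0.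
have geo : \sum_(a < n | Num.sqrt 2 ^+ a * Num.sqrt v <= Num.sqrt U)
    Num.sqrt 2 ^+ a * Num.sqrt v <= 4 * Num.sqrt U.
  have hq := truncated_geometric_sum n _ _ _ h2 v0' W0.
  have h20 : 0 < Num.sqrt 2 - 1 :> R by lra.
  by rewrite -(ler_pM2l h20); have := sqrt2_ratio; nra.
apply: (@le_trans _ _ (\sum_(a < n | Num.sqrt 2 ^+ a * Num.sqrt v <= Num.sqrt U)
    2 * (Num.sqrt 2 ^+ a * Num.sqrt v) * Num.sqrt U / (1 + ln U))).
  rewrite big_mkcond [leRHS]big_mkcond; apply: ler_sum => a _.
  rewrite -sq ler_sqrt ?(ltW U0)//.
  have [/andP[u1 uU]|_] := boolP (1 < 2 ^+ a * v <= U).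
    by rewrite uU; exact: div_ln_le.
  by case: ifP => // _; rewrite !mulr_ge0 ?sqrtr_ge0// invr_ge0 addr_ge0.
rewrite -!mulr_suml -mulr_sumr ler_wpM2r ?invr_ge0 ?addr_ge0//.
have -> : 8 * U = 2 * (4 * Num.sqrt U) * Num.sqrt U.
  by rewrite -{1}(sqr_sqrtr (ltW U0)); ring.
by rewrite ler_wpM2r// ler_wpM2l.
Qed.

(* The exponent in the bound [binomial n s <= exp (entropy n s)]; it is [0] at
   [s = 0]. *)
Definition entropy (n s : nat) : R := s%:R * (1 + ln (n%:R / s%:R)).

Lemma entropy_ge0 n s : (s <= n)%N -> 0 <= entropy n s.
Proof.
move=> sn; rewrite mulr_ge0// addr_ge0//.
(* For [s = 0] the conventions [n / 0 = 0] and [ln 0 = 0] apply. *)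
have [->|s0] := posnP s; first by rewrite invr0 mulr0 ln0.
by rewrite ln_ge0// ler_pdivlMr ?ltr0n// mul1r ler_nat.
Qed.

(* [ln x <= x - 1] at [x = n / (q ^ 2 * s)]. *)
Lemma entropy_scale n s (q : R) : 1 <= q ->
  q * entropy n s <= 2 * (q * s%:R) * (1 + ln q) + n%:R / q.
Proof.
move=> q1; have q0 : 0 < q by lra.
have lq : 0 <= ln q by rewrite ln_ge0.
have [->|s0] := posnP s.
  by rewrite /entropy !(mul0r, mulr0) add0r divr_ge0// ltW.
have [->|n0] := posnP n.
  rewrite /entropy !mul0r ln0// !addr0 mulr1.
  have : 0 < q * s%:R by rewrite mulr_gt0 ?ltr0n.
  by nra.
have s0' : 0 < s%:R :> R by rewrite ltr0n.
have n0' : 0 < n%:R :> R by rewrite ltr0n.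
have h := ln_leB1 (n%:R / (q ^+ 2 * s%:R)).
have {h} h : ln (n%:R / s%:R) - 2 * ln q <= n%:R / (q ^+ 2 * s%:R) - 1.
  have -> : ln (n%:R / s%:R) - 2 * ln q = ln (n%:R / (q ^+ 2 * s%:R)).
    by rewrite !(ln_div, lnM, lnXn) ?posrE ?mulr_gt0 ?exprn_gt0// mulr2n; ring.
  by apply: h; rewrite divr_gt0// mulr_gt0// exprn_gt0.
have h2 : s%:R * (ln (n%:R / s%:R) - 2 * ln q) <= n%:R / q ^+ 2 - s%:R.
  have -> : n%:R / q ^+ 2 - s%:R = s%:R * (n%:R / (q ^+ 2 * s%:R) - 1).
    by field; rewrite !gt_eqF.
  by rewrite ler_wpM2l// ltW.
have h3 : q * entropy n s <= q * (2 * s%:R * ln q + n%:R / q ^+ 2).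
  by rewrite ler_wpM2l ?(ltW q0)// /entropy; lra.
have e3 : q * (n%:R / q ^+ 2) = n%:R / q by field; rewrite gt_eqF.
have : 0 <= q * s%:R by rewrite mulr_ge0// ltW.
by nra.
Qed.

(** For fixed [b], the sum over [a] is dyadic with cutoff [U = 4^b]; [entropy_scale] at [q = 4^b]
    cancels the logarithm and leaves [8 rho (2 4^b t_b + N 4^-b)]. Summing over [b] gives
    [8 rho (8 N + 2 N)]. *)
Lemma entropy_dyadic_sum N M (t : 'I_M -> nat) (rho : R) :
  0 < rho -> (forall b, (t b <= N)%N) -> (\sum_(b < M) 4 ^ b * t b <= 4 * N)%N ->
  \sum_(b < M) \sum_(a < M | 1 < 2 ^+ (a + b + 2) / rho <= 4 ^+ b)
     2 ^+ (a + b + 2) * (entropy N (t b) / (1 + ln (2 ^+ (a + b + 2) / rho)))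
    <= 80%:R * (rho * N%:R).
Proof.
move=> rho0 tN ht.
have step (b : 'I_M) :
  \sum_(a < M | 1 < 2 ^+ (a + b + 2) / rho <= 4 ^+ b)
     2 ^+ (a + b + 2) * (entropy N (t b) / (1 + ln (2 ^+ (a + b + 2) / rho)))
    <= 8 * rho * (2 * (4 ^+ b * (t b)%:R) + N%:R * 4^-1 ^+ b).
  pose v : R := 2 ^+ (b + 2) / rho.
  have v0 : 0 < v by rewrite divr_gt0// exprn_gt0.
  have U1 : 1 <= 4 ^+ b :> R by rewrite exprn_ege1// ler1n.
  have uE (a : nat) : 2 ^+ (a + b + 2) / rho = 2 ^+ a * v.
    by rewrite -addnA exprD mulrA.
  have -> : \sum_(a < M | 1 < 2 ^+ (a + b + 2) / rho <= 4 ^+ b)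
     2 ^+ (a + b + 2) * (entropy N (t b) / (1 + ln (2 ^+ (a + b + 2) / rho)))
    = rho * entropy N (t b) *
      \sum_(a < M | 1 < 2 ^+ a * v <= 4 ^+ b)
        2 ^+ a * v / (1 + ln (2 ^+ a * v)).
    rewrite mulr_sumr; apply: eq_big => a; first by rewrite uE.
    move=> _; rewrite uE.
    have -> : 2 ^+ (a + b + 2) = rho * (2 ^+ a * v).
      by rewrite -uE mulrCA divff ?mulr1// gt_eqF.
    by ring.
  have e0 : 0 <= entropy N (t b) by exact: entropy_ge0.
  apply: (@le_trans _ _ (rho * entropy N (t b) *
      (8 * 4 ^+ b / (1 + ln (4 ^+ b))))).
    by rewrite ler_wpM2l ?(mulr_ge0 (ltW rho0) e0)//; exact: dyadic_div_ln_sum.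
  have hs := entropy_scale N (t b) _ U1.
  have l0 : 0 <= ln (4 ^+ b : R) by rewrite ln_ge0.
  have -> : rho * entropy N (t b) * (8 * 4 ^+ b / (1 + ln (4 ^+ b)))
    = 8 * rho * ((4 ^+ b * entropy N (t b)) / (1 + ln (4 ^+ b))) by ring.
  rewrite ler_wpM2l ?mulr_ge0 ?(ltW rho0)// ler_pdivrMr ?ltr_pwDl//.
  apply: (le_trans hs); rewrite [leRHS]mulrDl exprVn lerD2l.
  have h0 : 0 <= N%:R / 4 ^+ b :> R by rewrite divr_ge0// exprn_ge0.
  by rewrite ler_peMr//; lra.
apply: (le_trans (ler_sum _ (fun b _ => step b))).
rewrite -mulr_sumr big_split /= -!mulr_sumr.
have h1 : \sum_(b < M) 4 ^+ b * (t b)%:R <= 4 * N%:R :> R.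
  rewrite -natrM -(ler_nat R) natr_sum in ht *; apply: le_trans ht.
  by apply: ler_sum => b _; rewrite natrM natrX.
have h2 n : \sum_(k < n) 4^-1 ^+ k <= 4 / 3 * (1 - 4^-1 ^+ n) :> R.
  elim: n => [|n IH]; first by rewrite big_ord0 expr0; lra.
  by rewrite big_ord_recr /= exprS; lra.
have h3 : \sum_(k < M) 4^-1 ^+ k <= 2 :> R.
  apply: (le_trans (h2 M)).
  have : 0 <= 4^-1 ^+ M :> R by rewrite exprn_ge0// invr_ge0.
  by lra.
have hN : 0 <= N%:R :> R by [].
have -> : 80%:R * (rho * N%:R) = 8 * rho * (10%:R * N%:R) by ring.
rewrite ler_wpM2l ?mulr_ge0 ?(ltW rho0)//.
have : N%:R * \sum_(k < M) 4^-1 ^+ k <= N%:R * 2 :> R by rewrite ler_wpM2l.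
by lra.
Qed.

End DyadicSums.

(** * Heavy pairs for a matrix with bounded degrees and the discrepancy property *)

Section HeavyPairs.
Context {R : realType} {N : nat} {A : 'I_N -> 'I_N -> R} {rho k K : R}.
Context (N0 : (0 < N)%N) (rho0 : 0 < rho) (k0 : 0 <= k) (K0 : 0 <= K)
  (A0 : forall i j, 0 <= A i j).
Context (Arow : forall i, \sum_j A i j <= k * rho ^+ 2)
  (Acol : forall j, \sum_i A i j <= k * rho ^+ 2).
Context (Adisc : forall (S T : {set 'I_N}) m, (m <= 8 * N)%N ->
  1 <= 2 ^+ (m + 2) / rho ->
  \sum_(i in S) \sum_(j in T) A i j <=
    expR 1 * (2 ^+ (m + 2) / rho) * (2 * rho ^+ 2 / N%:R * (#|S|%:R * #|T|%:R))
    + K * ((entropy N #|S| + entropy N #|T|) / (1 + ln (2 ^+ (m + 2) / rho)))).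

(** The condition on [j] gives [x_i y_j <= 8 x_i^2 / rho]; the row sum turns this into
    [8 k rho x_i^2], and the squares sum to at most [4 N]. *)
Lemma unbalanced_rows (B : 'I_N -> 'I_N -> R) (x y : 'I_N -> nat) :
  (forall i j, 0 <= B i j) -> (forall i, \sum_j B i j <= k * rho ^+ 2) ->
  (\sum_i x i ^ 2 <= 4 * N)%N ->
  \sum_i \sum_(j | rho * (y j)%:R <= 8 * (x i)%:R) (x i)%:R * (y j)%:R * B i j
    <= 32%:R * k * (rho * N%:R).
Proof.
move=> B0 Brow hx.
have row i : \sum_(j | rho * (y j)%:R <= 8 * (x i)%:R)
    (x i)%:R * (y j)%:R * B i j <= 8 * k * rho * (x i ^ 2)%N%:R.
  apply: (@le_trans _ _ (\sum_j 8 / rho * (x i ^ 2)%N%:R * B i j)).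
    rewrite big_mkcond; apply: ler_sum => j _; case: ifP => [h|_]; last first.
      by rewrite !mulr_ge0 ?invr_ge0 ?(ltW rho0).
    have -> : 8 / rho * (x i ^ 2)%N%:R = (x i)%:R * (8 * (x i)%:R / rho).
      by rewrite natrX; ring.
    by rewrite ler_wpM2r// ler_wpM2l// ler_pdivlMr// mulrC.
  rewrite -mulr_sumr.
  have -> : 8 * k * rho * (x i ^ 2)%N%:R
      = 8 / rho * (x i ^ 2)%N%:R * (k * rho ^+ 2).
    by field; rewrite gt_eqF.
  by rewrite ler_wpM2l// !mulr_ge0 ?invr_ge0 ?(ltW rho0).
apply: (le_trans (ler_sum _ (fun i _ => row i))); rewrite -mulr_sumr -natr_sum.
have -> : 32%:R * k * (rho * N%:R) = 8 * k * rho * (4 * N)%N%:R.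
  by rewrite natrM; ring.
by rewrite ler_wpM2l ?ler_nat// !mulr_ge0 ?(ltW rho0).
Qed.

(** The level is the integer part of the binary logarithm. It is below [x i <= x i ^ 2 <= 4 N], a
    crude bound that supplies a finite index type. Zero coordinates get an arbitrary level, which is
    why [level_set] excludes them. *)
Lemma exists_level (x : 'I_N -> nat) : (\sum_i x i ^ 2 <= 4 * N)%N ->
  exists lev : 'I_N -> 'I_(4 * N).+1,
    forall i, (0 < x i -> 2 ^ lev i <= x i < 2 ^ (lev i).+1)%N.
Proof.
move=> hx; exists (fun i => inord (trunc_log 2 (x i))) => i xi.
rewrite inordK; first exact: trunc_log_bounds.
rewrite ltnS.
apply: leq_trans hx; rewrite (bigD1 i)//=; apply: leq_trans (leq_addr _ _).
have h := trunc_logP (isT : 1 < 2)%N xi.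
apply: (@leq_trans (x i)); last by rewrite leq_pmulr.
by apply: leq_trans h; apply/ltnW/ltn_expl.
Qed.

Definition level_set M (x : 'I_N -> nat) (lev : 'I_N -> 'I_M) (a : 'I_M) :=
  [set i | (0 < x i)%N && (lev i == a)]%SET.

Lemma sum_level_set M (x : 'I_N -> nat) (lev : 'I_N -> 'I_M) :
  (forall i, 0 < x i -> 2 ^ lev i <= x i)%N ->
  (\sum_i x i ^ 2 <= 4 * N)%N ->
  (\sum_(a < M) 4 ^ a * #|level_set M x lev a| <= 4 * N)%N.
Proof.
move=> hlev hx; apply: leq_trans hx.
apply: (@leq_trans (\sum_(i | (0 < x i)%N) x i ^ 2)%N); last first.
  by rewrite big_mkcond leq_sum// => i _; case: ifP.
rewrite (partition_big lev predT)//=; apply: leq_sum => a _.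
rewrite mulnC -sum_nat_const /level_set.
under eq_bigl do rewrite inE.
apply: leq_sum => i /andP[xi /eqP <-].
by rewrite (_ : 4 = 2 ^ 2)%N// -expnM mulnC expnM leq_exp2r// hlev.
Qed.

(** Pairs are grouped by levels [(a, b)] and the discrepancy bound is applied with
    [u = 2^(a + b + 2) / rho]. Heaviness forces [u > 1]; the two balance conditions force [u <= 4^a]
    and [u <= 4^b], the cutoffs of [entropy_dyadic_sum]. *)
Lemma balanced_heavy_pairs (x y : 'I_N -> nat) :
  (\sum_i x i ^ 2 <= 4 * N)%N -> (\sum_i y i ^ 2 <= 4 * N)%N ->
  \sum_(p : 'I_N * 'I_N | [&& rho < (x p.1)%:R * (y p.2)%:R,
      8 * (x p.1)%:R < rho * (y p.2)%:R & 8 * (y p.2)%:R < rho * (x p.1)%:R])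
     (x p.1)%:R * (y p.2)%:R * A p.1 p.2
    <= (1536%:R + 160%:R * K) * (rho * N%:R).
Proof.
move=> hx hy.
have [lx hlx] := exists_level _ hx; have [ly hly] := exists_level _ hy.
set M := (4 * N).+1 in lx hlx ly hly.
have e4 (m : nat) : 4 ^+ m = 2 ^+ m * 2 ^+ m :> R.
  by rewrite -expr2 exprAC (_ : 2 ^+ 2 = 4)//; ring.
pose S := level_set M x lx; pose T := level_set M y ly.
have hS : (\sum_(a < M) 4 ^ a * #|S a| <= 4 * N)%N.
  by apply: sum_level_set => // i /hlx/andP[].
have hT : (\sum_(a < M) 4 ^ a * #|T a| <= 4 * N)%N.
  by apply: sum_level_set => // i /hly/andP[].
pose u (a b : 'I_M) : R := 2 ^+ (a + b + 2) / rho.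
pose cond (q : 'I_M * 'I_M) :=
  [&& 1 < u q.1 q.2, u q.1 q.2 <= 4 ^+ q.1 & u q.1 q.2 <= 4 ^+ q.2].
pose E (q : 'I_M * 'I_M) := \sum_(i in S q.1) \sum_(j in T q.2) A i j.
rewrite (partition_big (fun p => (lx p.1, ly p.2)) cond) /=; last first.
  move=> [i j] /= /and3P[h1 h2 h3].
  have xi : (0 < x i)%N.
    by rewrite lt0n; apply: contraTneq h1 => ->; rewrite mul0r -leNgt ltW.
  have yj : (0 < y j)%N.
    by rewrite lt0n; apply: contraTneq h1 => ->; rewrite mulr0 -leNgt ltW.
  have /andP[x1 x2] := hlx _ xi; have /andP[y1 y2] := hly _ yj.
  rewrite -!(ltr_nat R) -!(ler_nat R) !natrX in x1 x2 y1 y2.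
  have a0 : 0 < 2 ^+ lx i :> R by rewrite exprn_gt0.
  have b0 : 0 < 2 ^+ ly j :> R by rewrite exprn_gt0.
  rewrite exprS in x2; rewrite exprS in y2.
  rewrite /cond /u /= ltr_pdivlMr// !ler_pdivrMr// !exprD !e4 mul1r.
  apply/and3P; split.
  - apply: (lt_le_trans h1); apply: (@le_trans _ _
      ((2 * 2 ^+ lx i) * (2 * 2 ^+ ly j))); last by rewrite expr2; lra.
    by rewrite ler_pM// ltW.
  - have : 8 * 2 ^+ ly j <= rho * (2 * 2 ^+ lx i).
      apply: (@le_trans _ _ (rho * (x i)%:R)); last by rewrite ler_pM2l// ltW.
      by apply: le_trans (ltW h3); rewrite ler_pM2l.
    by move=> h; rewrite expr2; nra.
  - have : 8 * 2 ^+ lx i <= rho * (2 * 2 ^+ ly j).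
      apply: (@le_trans _ _ (rho * (y j)%:R)); last by rewrite ler_pM2l// ltW.
      by apply: le_trans (ltW h2); rewrite ler_pM2l.
    by move=> h; rewrite expr2; nra.
(* On the levels [a] and [b], [x_i < 2^(a + 1)] and [y_j < 2^(b + 1)]. *)
apply: (@le_trans _ _ (\sum_(q | cond q) 2 ^+ (q.1 + q.2 + 2) * E q)).
  apply: ler_sum => -[a b] _ /=.
  rewrite /E pair_big_dep /= mulr_sumr big_mkcond [leRHS]big_mkcond.
  apply: ler_sum => -[i j] _ /=.
  case: ifPn => [/andP[/and3P[h1 _ _] /eqP[lxi lyj]]|_]; last first.
    by case: ifP => // _; rewrite mulr_ge0 ?exprn_ge0.
  have xi : (0 < x i)%N.
    by rewrite lt0n; apply: contraTneq h1 => ->; rewrite mul0r -leNgt ltW.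
  have yj : (0 < y j)%N.
    by rewrite lt0n; apply: contraTneq h1 => ->; rewrite mulr0 -leNgt ltW.
  rewrite !inE xi yj lxi lyj !eqxx /= ler_wpM2r//.
  have /andP[_ x2] := hlx _ xi; have /andP[_ y2] := hly _ yj.
  rewrite -natrM -natrX ler_nat addn2 -addSn -addnS expnD -lxi -lyj.
  by rewrite leq_mul// ltnW.
pose Y a b := entropy N #|S a| / (1 + ln (u a b)).
pose Z a b := entropy N #|T b| / (1 + ln (u a b)).
have Sent a : 0 <= entropy N #|S a| :> R.
  by rewrite entropy_ge0// -[leqRHS]card_ord max_card.
have Tent a : 0 <= entropy N #|T a| :> R.
  by rewrite entropy_ge0// -[leqRHS]card_ord max_card.
(* The factor 96 is [32 * 3]: 32 collects the powers of two and the 2 in the mean density, and 3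
   bounds [e]. *)
apply: (@le_trans _ _ (\sum_(q | cond q) (96%:R * rho / N%:R *
    ((4 ^ q.1 * #|S q.1|)%N%:R * (4 ^ q.2 * #|T q.2|)%N%:R)
    + K * (2 ^+ (q.1 + q.2 + 2) * Y q.1 q.2)
    + K * (2 ^+ (q.1 + q.2 + 2) * Z q.1 q.2)))).
  apply: ler_sum => -[a b] /and3P[/= u1 _ _].
  have ab : (a + b <= 8 * N)%N.
    rewrite (_ : 8 * N = 4 * N + 4 * N)%N; last by rewrite -mulnDl.
    by rewrite leq_add// -ltnS.
  have p0 : 0 <= 2 ^+ (a + b + 2) :> R by rewrite exprn_ge0.
  have := ler_wpM2l p0 (Adisc (S a) (T b) _ ab (ltW u1)).
  move=> /le_trans; apply; rewrite mulrDr -addrA lerD//; last first.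
    by rewrite /Y /Z -/(u a b); lra.
  have -> : 2 ^+ (a + b + 2) * (expR 1 * (2 ^+ (a + b + 2) / rho)
      * (2 * rho ^+ 2 / N%:R * (#|S a|%:R * #|T b|%:R)))
    = expR 1 * (32%:R * rho / N%:R *
       ((4 ^ a * #|S a|)%N%:R * (4 ^ b * #|T b|)%N%:R)).
    rewrite !natrM !natrX !exprD !e4.
    by field; rewrite pnatr_eq0 -lt0n N0 gt_eqF.
  set V := (X in expR 1 * X).
  have V0 : 0 <= V by rewrite !mulr_ge0 ?invr_ge0 ?(ltW rho0).
  have -> : 96%:R * rho / N%:R *
     ((4 ^ a * #|S a|)%N%:R * (4 ^ b * #|T b|)%N%:R) = 3 * V by rewrite /V; ring.
  by rewrite ler_wpM2r// expR1_le3.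
rewrite !big_split /= -!mulr_sumr.
have -> : (1536%:R + 160%:R * K) * (rho * N%:R) = 1536%:R * (rho * N%:R)
  + K * (80%:R * (rho * N%:R)) + K * (80%:R * (rho * N%:R)) by ring.
rewrite !lerD//.
(* The mean term factorizes over the two families of levels: [96 * 4 * 4 = 1536]. *)
- apply: (@le_trans _ _ (96%:R * rho / N%:R * ((4 * N)%N%:R * (4 * N)%N%:R))).
    rewrite ler_wpM2l ?mulr_ge0 ?invr_ge0 ?(ltW rho0)//.
    apply: (@le_trans _ _ ((\sum_(a < M) 4 ^ a * #|S a|)%N%:R
        * (\sum_(b < M) 4 ^ b * #|T b|)%N%:R)); last by rewrite ler_pM ?ler_nat.
    rewrite !natr_sum big_distrlr pair_big_dep /= big_mkcond.
    by apply: ler_sum => q _; case: ifP.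
  by rewrite natrM le_eqVlt; apply/orP; left; apply/eqP; field;
     rewrite pnatr_eq0 -lt0n.
- rewrite ler_wpM2l//.
  apply: le_trans (entropy_dyadic_sum N M (fun a => #|S a|) _ rho0 _ hS);
    last by move=> a; rewrite -[leqRHS]card_ord max_card.
  rewrite pair_big_dep /= big_mkcond [leRHS]big_mkcond.
  apply: ler_sum => -[a b] _; rewrite /cond /Y /u /= [(b + a)%N]addnC.
  case: ifP => [/and3P[-> -> _]//|_]; case: ifP => // /andP[u1 _].
  by rewrite mulr_ge0 ?exprn_ge0// divr_ge0// addr_ge0// ln_ge0// ltW.
- rewrite ler_wpM2l//.
  apply: le_trans (entropy_dyadic_sum N M (fun a => #|T a|) _ rho0 _ hT);
    last by move=> a; rewrite -[leqRHS]card_ord max_card.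
  rewrite (exchange_big_dep predT)//= pair_big_dep /= big_mkcond [leRHS]big_mkcond.
  apply: ler_sum => -[a b] _; rewrite /cond /Z /u /=.
  case: ifP => [/and3P[-> _ ->]//|_]; case: ifP => // /andP[u1 _].
  by rewrite mulr_ge0 ?exprn_ge0// divr_ge0// addr_ge0// ln_ge0// ltW.
Qed.

(** A heavy pair is balanced, or is covered by [unbalanced_rows] for [A] or for its transpose;
    overlaps are harmless as all terms are nonnegative. *)
Lemma heavy_pairs (x y : 'I_N -> nat) :
  (\sum_i x i ^ 2 <= 4 * N)%N -> (\sum_i y i ^ 2 <= 4 * N)%N ->
  \sum_(p : 'I_N * 'I_N | rho < (x p.1)%:R * (y p.2)%:R)
     (x p.1)%:R * (y p.2)%:R * A p.1 p.2
    <= (1536%:R + 160%:R * K + 64%:R * k) * (rho * N%:R).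
Proof.
move=> hx hy.
have hrow := unbalanced_rows A x y A0 Arow hx.
have := unbalanced_rows (fun j i => A i j) y x (fun j i => A0 i j) Acol hy.
have hbal := balanced_heavy_pairs x y hx hy.
rewrite (exchange_big_dep predT)//= pair_big_dep /= => hcol.
rewrite pair_big_dep /= in hrow.
have -> : (1536%:R + 160%:R * K + 64%:R * k) * (rho * N%:R)
  = (1536%:R + 160%:R * K) * (rho * N%:R) + 32%:R * k * (rho * N%:R)
    + 32%:R * k * (rho * N%:R) by ring.
apply: le_trans (lerD (lerD hbal hrow) hcol).
rewrite big_mkcond [X in X + _ + _]big_mkcond [X in _ + X + _]big_mkcond.
rewrite [X in _ + X]big_mkcond -!big_split /=; apply: ler_sum => -[i j] _ /=.
rewrite (mulrC (y j)%:R).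
have F0 : 0 <= (x i)%:R * (y j)%:R * A i j by rewrite !mulr_ge0.
case: ltP => h1 /=; last by rewrite add0r addr_ge0//; case: ifP.
case: (ltP (8 * (x i)%:R)) => h2 /=; last by rewrite add0r lerDl; case: ifP.
by case: ltP => h3 /=; rewrite ?addr0 ?add0r.
Qed.

End HeavyPairs.

(** * Hypergraphs *)

Section EdgeForms.
Context {R : realType} {N : nat}.
Implicit Types (f : 'I_N * 'I_N -> R) (e : {set 'I_N}) (G : {set {set 'I_N}}).

Definition edge_pair e (p : 'I_N * 'I_N) :=
  [&& p.1 != p.2, p.1 \in e & p.2 \in e].

(* The inner product of [f] with the adjacency matrix of the single edge [e]. *)
Definition edge_form f e : R := \sum_(p | edge_pair e p) f p.

Lemma card_edge_pair e : #|edge_pair e| = (#|e| * #|e|.-1)%N.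
Proof.
rewrite -[LHS]sum1_card (eq_bigl (fun p : 'I_N * 'I_N =>
   (p.1 \in e) && ((p.2 \in e) && (p.1 != p.2)))); last first.
  by move=> p; rewrite unfold_in /edge_pair andbC -andbA.
rewrite -(pair_big_dep (mem e) (fun i j => (j \in e) && (i != j))
  (fun _ _ => 1%N)) /=.
rewrite -sum_nat_const; apply: eq_bigr => i ie.
rewrite (cardD1 i) ie /= -sum1_card; apply: eq_bigl => j.
by rewrite !inE andbC eq_sym.
Qed.

Lemma edge_form_ge0 f e : (forall p, 0 <= f p) -> 0 <= edge_form f e.
Proof. by move=> f0; apply: sumr_ge0. Qed.

Lemma edge_form_le f e (B : R) : (forall p, f p <= B) ->
  edge_form f e <= (#|e| * #|e|.-1)%N%:R * B.
Proof.
move=> fB; rewrite -card_edge_pair mulr_natl -sumr_const.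
exact: ler_sum.
Qed.

Lemma edge_form_sqr_le f e :
  edge_form f e ^+ 2
    <= (#|e| * #|e|.-1)%N%:R * edge_form (fun p => f p ^+ 2) e.
Proof. by rewrite -card_edge_pair; exact: sqr_sum_le_card. Qed.

(** Interchanging edges and pairs gives the pairing of [f] with a matrix: the adjacency matrix when
    [w] is the indicator of [G], its mean when [w] is the inclusion probability. *)
Lemma sum_edge_form f (w : {set 'I_N} -> R) :
  \sum_e w e * edge_form f e
    = \sum_p f p * (if p.1 == p.2 then 0
                    else \sum_(e : {set 'I_N} | (p.1 \in e) && (p.2 \in e)) w e).
Proof.
under eq_bigr do rewrite mulr_sumr.
rewrite (exchange_big_dep predT)//=; apply: eq_bigr => p _.
rewrite /edge_pair; case: eqP => _ /=; first by rewrite big_pred0 ?mulr0.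
by rewrite mulr_sumr; apply: eq_bigr => e _; rewrite mulrC.
Qed.

Lemma sum_adjacency f G :
  \sum_p f p * adjacency R G p.1 p.2 = \sum_(e in G) edge_form f e.
Proof.
transitivity (\sum_e (e \in G)%:R * edge_form f e); last first.
  rewrite [RHS]big_mkcond; apply: eq_bigr => e _.
  by case: (e \in G); rewrite ?mul1r ?mul0r.
rewrite sum_edge_form; apply: eq_bigr => p _; rewrite mxE; congr (_ * _).
case: eqP => // _; rewrite -sum1_card natr_sum.
rewrite big_mkcond [RHS]big_mkcond; apply: eq_bigr => e _.
by rewrite inE; case: (e \in G) => /=; case: ifP.
Qed.

End EdgeForms.

(** * Total weight of the edges through given vertices *)

(** Removing [B] is injective on supersets of [B] and lands in the subsets of the complement. *)
Lemma card_supersets (I : finType) (B : {set I}) (k : nat) :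
  (#|[set e : {set I} | (B \subset e) && (#|e| == k)]%SET|
     <= 'C(#|I| - #|B|, k - #|B|))%N.
Proof.
have -> : (#|I| - #|B|)%N = #|~: B|%SET by rewrite [RHS]cardsCs finset.setCK.
rewrite -cards_draws.
have inj : {in [set e : {set I} | (B \subset e) && (#|e| == k)]%SET &,
    injective (fun e => e :\: B)%SET}.
  move=> e e'; rewrite !inE => /andP[Be _] /andP[Be' _] ee'.
  by rewrite -(finset.setID e B) -(finset.setID e' B) ee'
     (finset.setIidPr Be) (finset.setIidPr Be').
rewrite -(card_in_imset inj).
apply/subset_leq_card/fintype.subsetP => X /imsetP[e].
rewrite inE => /andP[Be /eqP ek] ->.
rewrite inE cardsD (finset.setIidPr Be) ek eqxx andbT.
by rewrite finset.setDE finset.subsetIr.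
Qed.

Section EdgeWeights.
Context {R : realType} {N : nat} {LL : {fset nat}} {w : {set 'I_N} -> R}
  {dmax : nat -> R}.
Context (LL2 : forall l, l \in LL -> (2 <= l)%N) (w0 : forall e, 0 <= w e)
  (dmax0 : forall l, 0 <= dmax l)
  (wLL : forall e : {set 'I_N}, #|e| \notin LL -> w e = 0)
  (wd : forall e : {set 'I_N}, #|e| \in LL ->
     w e <= dmax #|e| / 'C(N.-1, #|e|.-1)%:R).

Let d : R := \sum_(l <- LL) l.-1%:R * dmax l.

Lemma sum_by_size (Q : pred {set 'I_N}) (c : nat -> R) :
  \sum_(e | Q e) c #|e| * w e
    = \sum_(l <- LL) \sum_(e : {set 'I_N} | Q e && (#|e| == l)) c l * w e.
Proof.
rewrite (exchange_big_dep Q) /=; last by move=> ? ? _ /andP[].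
apply: eq_bigr => e Qe; rewrite Qe /=.
have [eLL|eLL] := boolP (#|e| \in LL); last first.
  by rewrite wLL// big1 ?mulr0// => l _; rewrite mulr0.
rewrite (eq_bigl (pred1 #|e|)); last by move=> l; rewrite /= eq_sym.
by rewrite -big_filter filter_pred1_uniq ?big_seq1// fset_uniq.
Qed.

Lemma weight_size_le (B : {set 'I_N}) l : l \in LL ->
  \sum_(e : {set 'I_N} | (B \subset e) && (#|e| == l)) w e
    <= 'C(N - #|B|, l - #|B|)%:R * (dmax l / 'C(N.-1, l.-1)%:R).
Proof.
move=> lLL; have := card_supersets _ B l.
rewrite -(ler_nat R) card_ord => h.
have c0 : 0 <= dmax l / 'C(N.-1, l.-1)%:R by rewrite divr_ge0.
apply: le_trans (ler_wpM2r c0 h).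
rewrite mulr_natl -sumr_const; under [leRHS]eq_bigl do rewrite inE.
apply: ler_sum => e /andP[_ /eqP el].
by rewrite -el wd// el.
Qed.

(** The number of [l]-sets through a vertex is the normalizing binomial itself, so size [l]
    contributes at most [(l - 1) d_l]. *)
Lemma degree_weight_le (i : 'I_N) :
  \sum_(e : {set 'I_N} | i \in e) #|e|.-1%:R * w e <= d.
Proof.
rewrite (sum_by_size _ (fun l => l.-1%:R)); rewrite /d big_seq [leRHS]big_seq.
apply: ler_sum => l lLL.
rewrite -mulr_sumr ler_wpM2l//.
under eq_bigl do rewrite -finset.sub1set.
apply: (le_trans (weight_size_le _ _ lLL)); rewrite cards1 !subn1.
(* The binomial vanishes when [N < l]; the quotient is then 0 by convention. *)
have [->|c0] := eqVneq ('C(N.-1, l.-1)%:R : R) 0; first by rewrite mul0r.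
by rewrite mulrCA divff// mulr1.
Qed.

(** The ratio of [C(N - 2, l - 2)] to [C(N - 1, l - 1)] is [(l - 1) / (N - 1)], so the sum is at
    most [d / (N - 1)], and [N <= 2 (N - 1)]. *)
Lemma pair_weight_le (i j : 'I_N) : i != j ->
  \sum_(e : {set 'I_N} | (i \in e) && (j \in e)) w e <= 2 * d / N%:R.
Proof.
move=> ij.
have N2 : (2 <= N)%N.
  rewrite -[N]card_ord; apply: leq_trans (max_card [set i; j]%SET).
  by rewrite cards2 ij.
have N1 : 0 < N.-1%:R :> R by rewrite ltr0n; case: N N2 => [|[]].
have d0 : 0 <= d by apply: sumr_ge0 => l _; rewrite mulr_ge0.
apply: (@le_trans _ _ (d / N.-1%:R)); last first.
  have hN : N%:R <= 2 * N.-1%:R :> R.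
    by rewrite -natrM ler_nat; case: N N2 => // n; rewrite mul2n -addnn; lia.
  rewrite ler_pdivrMr// mulrAC ler_pdivlMr ?ltr0n ?(leq_trans _ N2)//.
  by rewrite mulrAC mulrC ler_wpM2r.
rewrite ler_pdivlMr// mulrC mulr_sumr.
rewrite (eq_bigr (fun e => N.-1%:R * w e))//.
rewrite (sum_by_size _ (fun=> N.-1%:R)); rewrite /d big_seq [leRHS]big_seq.
apply: ler_sum => l lLL.
rewrite -mulr_sumr.
rewrite (eq_bigl (fun e : {set 'I_N} =>
   ([set i; j]%SET \subset e) && (#|e| == l))); last first.
  by move=> e; rewrite finset.subUset !finset.sub1set.
have h := weight_size_le [set i; j]%SET _ lLL.
apply: (le_trans (ler_wpM2l (ltW N1) h)); rewrite cards2 ij.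
have := LL2 _ lLL; case: l lLL {h} => [|[|l]]// lLL _.
rewrite !subn2 /=.
have /(congr1 (fun n => n%:R : R)) := mul_bin_diag N.-1 l.
rewrite !natrM [leLHS]mulrA => ->.
have [->|c0] := eqVneq ('C(N.-1, l.+1)%:R : R) 0.
  by rewrite mulr0 mul0r mulr_ge0.
by rewrite -mulrA (mulrCA _ (dmax _)) divff// mulr1.
Qed.

End EdgeWeights.

(** * Union bounds over vertex subsets *)

Section EntropyUnion.
Context {R : realType}.

(** One term of the binomial expansion: [C(n, s) x^s <= (1 + x)^n <= exp (n x)], taken at
    [x = s / n]. *)
Lemma bin_le_expR_entropy n s : (0 < s <= n)%N ->
  'C(n, s)%:R <= expR (entropy n s) :> R.
Proof.
move=> /andP[s0 sn].
have n0 : 0 < n%:R :> R by rewrite ltr0n (leq_trans s0).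
have s0' : 0 < s%:R :> R by rewrite ltr0n.
pose x : R := s%:R / n%:R.
have x0 : 0 < x by rewrite divr_gt0.
have h : 'C(n, s)%:R * x ^+ s <= expR s%:R.
  apply: (@le_trans _ _ ((1 + x) ^+ n)).
    rewrite exprDn (bigD1 (Ordinal (sn : (s < n.+1)%N)))//= expr1n mul1r.
    rewrite mulr_natl lerDl; apply: sumr_ge0 => i _.
    by rewrite mulrn_wge0// mulr_ge0 ?exprn_ge0// ltW.
  apply: (@le_trans _ _ (expR x ^+ n)).
    rewrite lerXn2r ?nnegrE ?expR_ge0 ?expR_ge1Dx//.
    by rewrite addr_ge0// ltW.
  by rewrite -expRM_natr /x mulfVK// gt_eqF.
have -> : expR (entropy n s) = expR s%:R / x ^+ s.
  rewrite /entropy mulrDr mulr1 expRD; congr (_ * _).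
  by rewrite expRM_natl lnK ?posrE ?divr_gt0// -exprVn invf_div.
by rewrite ler_pdivlMr ?exprn_gt0.
Qed.

(** [ln n = ln s + ln (n / s)], where [ln s <= s - 1] and [ln (n / s) <= s ln (n / s)]. *)
Lemma ln_le_entropy n s : (0 < s <= n)%N -> ln n%:R <= entropy n s :> R.
Proof.
move=> /andP[s0 sn].
have n0 : 0 < n%:R :> R by rewrite ltr0n (leq_trans s0).
have s1 : 1 <= s%:R :> R by rewrite ler1n.
have s0' : 0 < s%:R :> R by rewrite ltr0n.
have h : ln s%:R <= ln n%:R :> R by rewrite ler_ln ?posrE// ler_nat.
have h2 := ln_leB1 _ s0'.
by rewrite /entropy ln_div ?posrE//; nra.
Qed.

(** One copy of the entropy pays for the number of sets of each size; the other [kappa] copies leave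
    [n^(-kappa)] for each of the [n] sizes. *)
Lemma entropy_union n (kappa : R) : 0 <= kappa ->
  \sum_(S : {set 'I_n} | (0 < #|S|)%N) expR (- ((1 + kappa) * entropy n #|S|))
    <= n%:R * expR (- (kappa * ln n%:R)).
Proof.
move=> k0.
rewrite (partition_big (fun S : {set 'I_n} => inord #|S| : 'I_n.+1)
  (fun s => (0 < s)%N)) /=; last first.
  by move=> S; rewrite inordK// ltnS -[leqRHS]card_ord max_card.
rewrite big_mkcond big_ord_recl /= add0r.
rewrite -[in leRHS](card_ord n) mulr_natl -sumr_const card_ord.
apply: ler_sum => s _; set t := lift ord0 s.
have tn : (0 < t <= n)%N by rewrite /t lift0 ltn_ord.
apply: (@le_trans _ _ (\sum_(S : {set 'I_n} | #|S| == t)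
    expR (- ((1 + kappa) * entropy n t)))).
  rewrite big_mkcond [leRHS]big_mkcond; apply: ler_sum => S _.
  have St : (inord #|S| == t) = (#|S| == t).
    by rewrite -val_eqE /= inordK// ltnS -[leqRHS]card_ord max_card.
  rewrite St; case St' : (#|S| == t); last by rewrite andbF.
  by rewrite andbT (eqP St') (andP tn).1.
rewrite sumr_const -[leLHS]mulr_natl.
rewrite (_ : #|_| = 'C(n, t)); last first.
  have := card_draws 'I_n t; rewrite card_ord => <-; apply: eq_card => S.
  by rewrite !inE unfold_in.
have hb : 'C(n, t)%:R <= expR (entropy n t) :> R by exact: bin_le_expR_entropy.
apply: (le_trans (ler_wpM2r (expR_ge0 _) hb)).
rewrite -expRD ler_expR.
have h : ln n%:R <= entropy n t :> R by exact: ln_le_entropy.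
by have := ler_wpM2l k0 h; lra.
Qed.

End EntropyUnion.

(** * Tail bounds for light pairs, degrees and discrepancy *)

Section HypergraphTails.
Context {R : realType} {N L : nat} {LL : {fset nat}}
  {w : {set 'I_N} -> R} {law : {set {set 'I_N}} -> R} {dmax : nat -> R}.
Context (N2 : (2 <= N)%N) (L2 : (2 <= L)%N)
  (LL2 : forall l, l \in LL -> (2 <= l)%N)
  (LLL : forall l, l \in LL -> (l <= L)%N)
  (w01 : forall e, 0 <= w e <= 1) (law_ge0 : forall G, 0 <= law G)
  (law_incl : forall F : {set {set 'I_N}},
     \sum_(G : {set {set 'I_N}} | F \subset G) law G = \prod_(e in F) w e)
  (dmax0 : forall l, 0 <= dmax l)
  (wLL : forall e : {set 'I_N}, #|e| \notin LL -> w e = 0)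
  (wd : forall e : {set 'I_N}, #|e| \in LL ->
     w e <= dmax #|e| / 'C(N.-1, #|e|.-1)%:R).

Let d : R := \sum_(l <- LL) l.-1%:R * dmax l.
Let rho : R := Num.sqrt d.
Let pairs : R := L%:R * L.-1%:R.

Context (d0 : 0 < d).

Let rho0 : 0 < rho. Proof. by rewrite sqrtr_gt0. Qed.
Let rho2 : rho ^+ 2 = d. Proof. by rewrite sqr_sqrtr// ltW. Qed.
Let w0 e : 0 <= w e. Proof. by have /andP[] := w01 e. Qed.
Let N0 : 0 < N%:R :> R. Proof. by rewrite ltr0n (leq_trans _ N2). Qed.

Let L1 : 1 <= L.-1%:R :> R.
Proof. by rewrite ler1n -ltnS prednK// (leq_trans _ L2). Qed.

Let pairs2 : 2 <= pairs.
Proof.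
have : 2 <= L%:R :> R by rewrite ler_nat.
by have := L1; rewrite /pairs; nra.
Qed.

Let pairs0 : 0 < pairs. Proof. exact: lt_le_trans pairs2. Qed.

Lemma edge_pairs_le e : w e != 0 -> (#|e| * #|e|.-1)%N%:R <= pairs.
Proof.
move=> we; have eLL : #|e| \in LL by apply: contraNT we => /wLL ->.
by rewrite /pairs -natrM ler_nat leq_mul ?LLL// -!subn1 leq_sub2r ?LLL.
Qed.

Lemma mean_edge_form_le f : (forall p, 0 <= f p) ->
  \sum_e w e * edge_form f e <= 2 * d / N%:R * \sum_p f p.
Proof.
move=> f0; rewrite sum_edge_form mulr_sumr; apply: ler_sum => p _.
rewrite mulrC ler_wpM2r//; case: eqP => [_|/eqP pn].
  by rewrite divr_ge0 ?mulr_ge0 ?ltW.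
exact: (@pair_weight_le _ _ LL).
Qed.

(** Bernstein after scaling by [t = 1 / (2 pairs rho)], which brings edge forms below [1/2]. The
    threshold becomes [21 N] and the second moment is at most [8 N / pairs <= 4 N], so the exponent
    is at most [8 N - 21 N]. *)
Lemma light_tail (f : 'I_N * 'I_N -> R) :
  (forall p, f p <= rho) -> \sum_p f p ^+ 2 <= 16%:R * N%:R ^+ 2 ->
  \sum_(G : {set {set 'I_N}} | 42%:R * pairs * (rho * N%:R) <=
      \sum_(e in G) edge_form f e - \sum_e w e * edge_form f e) law G
    <= expR (- (13%:R * N%:R)).
Proof.
move=> f_le f_sqr.
pose t := (2 * pairs * rho)^-1.
have D0 : 0 < 2 * pairs * rho by exact: mulr_gt0 (mulr_gt0 _ pairs0) rho0.
have t0 : 0 < t by rewrite invr_gt0.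
rewrite (eq_bigl (fun G : {set {set 'I_N}} => 21%:R * N%:R
    <= \sum_(e in G) t * edge_form f e - \sum_e w e * (t * edge_form f e)));
  last first.
  move=> G; rewrite -mulr_sumr.
  have -> : \sum_e w e * (t * edge_form f e) = t * \sum_e w e * edge_form f e.
    by rewrite mulr_sumr; apply: eq_bigr => e _; rewrite mulrCA.
  rewrite -mulrBr.
  have -> : 21%:R * N%:R = t * (42%:R * pairs * (rho * N%:R)).
    by rewrite /t; field; rewrite !gt_eqF.
  by rewrite ler_pM2l.
have ta e : w e != 0 -> t * edge_form f e <= 1 / 2.
  move=> we; have h := edge_form_le f e _ f_le.
  rewrite /t mulrC ler_pdivrMr//.
  have := ler_wpM2r (ltW rho0) (edge_pairs_le _ we); lra.
apply: (le_trans (bernstein w01 law_ge0 law_incl _ _ ta)); rewrite ler_expR.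
have h : \sum_e w e * (t * edge_form f e) ^+ 2
    <= t ^+ 2 * pairs * (2 * d / N%:R * (16%:R * N%:R ^+ 2)).
  apply: (@le_trans _ _ (t ^+ 2 * pairs *
      \sum_e w e * edge_form (fun p => f p ^+ 2) e)).
    rewrite mulr_sumr; apply: ler_sum => e _.
    have [->|we] := eqVneq (w e) 0; first by rewrite !mul0r mulr0.
    rewrite exprMn [leRHS](_ : _ =
      w e * (t ^+ 2 * (pairs * edge_form (fun p => f p ^+ 2) e))); last by ring.
    rewrite ler_wpM2l// ler_pM2l ?exprn_gt0//.
    apply: (le_trans (edge_form_sqr_le f e)).
    by rewrite ler_wpM2r ?edge_pairs_le// edge_form_ge0// => p; exact: sqr_ge0.
  apply: ler_wpM2l; first exact: mulr_ge0 (exprn_ge0 _ (ltW t0)) (ltW pairs0).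
  apply: (le_trans (mean_edge_form_le _ (fun p => sqr_ge0 (f p)))).
  by apply: ler_wpM2l => //; rewrite divr_ge0// mulr_ge0// ltW.
have e1 : t ^+ 2 * pairs * (2 * d / N%:R * (16%:R * N%:R ^+ 2))
    = 8 * N%:R / pairs.
  by rewrite /t -rho2; field; rewrite !gt_eqF.
have e2 : 8 * N%:R / pairs <= 4 * N%:R.
  by rewrite ler_pdivrMr//; have := ler_wpM2l (ltW N0) pairs2; lra.
by rewrite e1 in h; lra.
Qed.

(* The exponent is scaled by [1 / (L - 1)], which bounds it by 1; the leading 2
   then comes from [e - 1 <= 2]. *)
Lemma degree_tail (c theta : R) (i : 'I_N) :
  0 < c -> 0 < theta -> c * ln N%:R <= d ->
  \sum_(G : {set {set 'I_N}} |
      (2 + L.-1%:R * (1 + theta) / c) * d <=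
         \sum_(e in G) (if i \in e then #|e|.-1%:R else 0)) law G
    <= expR (- ((1 + theta) * ln N%:R)).
Proof.
move=> c0 theta0 hd; have L0 : 0 < L.-1%:R :> R by have := L1; lra.
pose a (e : {set 'I_N}) : R := (if i \in e then #|e|.-1%:R else 0) / L.-1%:R.
rewrite (eq_bigl (fun G : {set {set 'I_N}} =>
   (2 + L.-1%:R * (1 + theta) / c) * d / L.-1%:R <= \sum_(e in G) a e));
  last by move=> G; rewrite -mulr_suml ler_pM2r ?invr_gt0.
apply: (le_trans (chernoff w01 law_ge0 law_incl _ _)); rewrite ler_expR.
have h : \sum_e w e * (expR (a e) - 1) <= 2 * d / L.-1%:R.
  apply: (@le_trans _ _ (2 / L.-1%:R *
      \sum_(e : {set 'I_N} | i \in e) #|e|.-1%:R * w e)); last first.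
    rewrite mulrAC ler_pM2r ?invr_gt0// ler_pM2l//.
    exact: (@degree_weight_le _ _ LL).
  rewrite mulr_sumr [leRHS]big_mkcond; apply: ler_sum => e _.
  have [we|we] := eqVneq (w e) 0.
    by rewrite we mul0r; case: ifP; rewrite ?mulr0.
  have eLL : #|e| \in LL by apply: contraNT we => /wLL ->.
  rewrite /a; case: ifP => ie; last by rewrite mul0r expR0 subrr mulr0.
  have a01 : 0 <= (#|e|.-1%:R / L.-1%:R : R) <= 1.
    rewrite divr_ge0//= ler_pdivrMr// mul1r ler_nat -!subn1 leq_sub2r//.
    exact: LLL.
  have := expR_chord _ 1 a01; rewrite mulr1 => h.
  have h3 := expR1_le3 (R := R).
  have -> : 2 / L.-1%:R * (#|e|.-1%:R * w e)
     = w e * (2 * (#|e|.-1%:R / L.-1%:R)) by ring.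
  by rewrite ler_wpM2l//; have /andP[a0 _] := a01; nra.
have : (1 + theta) * ln N%:R <= (1 + theta) * (d / c).
  by rewrite ler_wpM2l ?ler_pdivlMr//; lra.
(* The threshold splits into the mean part of the exponent and [(1 + theta) d / c], where
   [d / c >= ln N]. *)
have -> : (2 + L.-1%:R * (1 + theta) / c) * d / L.-1%:R
    = 2 * d / L.-1%:R + (1 + theta) * (d / c) by field; rewrite !gt_eqF.
by lra.
Qed.

(** Chernoff with parameter [ln r / pairs]: by the chord bound the mean part is at most
    [r mu / pairs], while the threshold contributes [ln r] times as much plus [(theta + 6) g]. The
    condition [r >= e] gives [ln r >= 1], so the mean part is absorbed. *)
Lemma discrepancy_tail (theta r : R) (S T : {set 'I_N}) :
  0 < theta -> expR 1 <= r ->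
  \sum_(G : {set {set 'I_N}} |
     r * (2 * d / N%:R * (#|S|%:R * #|T|%:R))
       + pairs * (theta + 6%:R) * ((entropy N #|S| + entropy N #|T|) / ln r)
     <= \sum_(e in G)
          edge_form (fun p => ((p.1 \in S) && (p.2 \in T))%:R) e) law G
    <= expR (- ((theta + 6%:R) * (entropy N #|S| + entropy N #|T|))).
Proof.
move=> theta0 er; set f := fun p : 'I_N * 'I_N => _.
have r0 : 0 < r by apply: lt_le_trans er; exact: expR_gt0.
have lr1 : 1 <= ln r by rewrite -(expRK 1) ler_ln ?posrE ?expR_gt0.
have lr0 : 0 < ln r by lra.
have f0 p : 0 <= f p by rewrite ler0n.
set mu := 2 * d / N%:R * _; set g := entropy N _ + entropy N _.
have fsum : \sum_p f p = #|S|%:R * #|T|%:R.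
  rewrite /f -natr_sum -natrM; congr _%:R.
  rewrite -(pair_bigA _ (fun i j => ((i \in S) && (j \in T) : nat))) /=.
  rewrite -!sum1_card big_distrlr /= [RHS]big_mkcond; apply: eq_bigr => i _.
  case: (i \in S); last by rewrite big1.
  by rewrite [RHS]big_mkcond; apply: eq_bigr => j _ /=; case: (j \in T).
rewrite (eq_bigl (fun G : {set {set 'I_N}} =>
   ln r / pairs * (r * mu + pairs * (theta + 6%:R) * (g / ln r))
     <= \sum_(e in G) ln r / pairs * edge_form f e)); last first.
  by move=> G; rewrite -mulr_sumr ler_pM2l ?divr_gt0.
apply: (le_trans (chernoff w01 law_ge0 law_incl _ _)); rewrite ler_expR.
have h : \sum_e w e * (expR (ln r / pairs * edge_form f e) - 1)
    <= r / pairs * mu.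
  apply: (@le_trans _ _ (r / pairs * \sum_e w e * edge_form f e)); last first.
    apply: ler_wpM2l; first exact: divr_ge0 (ltW r0) (ltW pairs0).
    by rewrite /mu -fsum; exact: mean_edge_form_le.
  rewrite mulr_sumr; apply: ler_sum => e _.
  have [->|we] := eqVneq (w e) 0; first by rewrite !mul0r mulr0.
  rewrite mulrCA ler_wpM2l//.
  have a01 : 0 <= edge_form f e / pairs <= 1.
    rewrite (divr_ge0 (edge_form_ge0 f e f0) (ltW pairs0)) ler_pdivrMr// mul1r.
    apply: (le_trans (edge_form_le f e 1 _)); last first.
      by rewrite mulr1; exact: edge_pairs_le.
    by move=> p; rewrite /f; case: (_ && _).
  have := expR_chord _ (ln r) a01; rewrite lnK// => h.
  have -> : ln r / pairs * edge_form f e = edge_form f e / pairs * ln r by ring.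
  have -> : r / pairs * edge_form f e = edge_form f e / pairs * r by ring.
  by have /andP[a0 _] := a01; nra.
have -> : ln r / pairs * (r * mu + pairs * (theta + 6%:R) * (g / ln r))
   = ln r * (r / pairs * mu) + (theta + 6%:R) * g by field; rewrite !gt_eqF.
have mu0 : 0 <= r / pairs * mu.
  by rewrite mulr_ge0 ?divr_ge0 ?mulr_ge0 ?(ltW r0) ?(ltW pairs0) ?(ltW d0).
by nra.
Qed.

End HypergraphTails.

(** * Failure events and the deterministic norm bound *)

Section HypergraphNorm.
Context {R : realType} {N L : nat} {LL : {fset nat}}
  {w : {set 'I_N} -> R} {law : {set {set 'I_N}} -> R} {dmax : nat -> R}.
Context (N2 : (2 <= N)%N) (L2 : (2 <= L)%N)
  (LL2 : forall l, l \in LL -> (2 <= l)%N)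
  (LLL : forall l, l \in LL -> (l <= L)%N)
  (w01 : forall e, 0 <= w e <= 1) (law_ge0 : forall G, 0 <= law G)
  (law_incl : forall F : {set {set 'I_N}},
     \sum_(G : {set {set 'I_N}} | F \subset G) law G = \prod_(e in F) w e)
  (dmax0 : forall l, 0 <= dmax l)
  (wLL : forall e : {set 'I_N}, #|e| \notin LL -> w e = 0)
  (wd : forall e : {set 'I_N}, #|e| \in LL ->
     w e <= dmax #|e| / 'C(N.-1, #|e|.-1)%:R).
Context {c theta : R}.

Let d : R := \sum_(l <- LL) l.-1%:R * dmax l.
Let rho : R := Num.sqrt d.
Let pairs : R := L%:R * L.-1%:R.
Let deg : R := 2 + L.-1%:R * (1 + theta) / c.

Context (c0 : 0 < c) (theta0 : 0 < theta) (cd : c * ln N%:R <= d).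

Let N0 : 0 < N%:R :> R. Proof. by rewrite ltr0n (leq_trans _ N2). Qed.

Let d0 : 0 < d.
Proof. by apply: lt_le_trans cd; rewrite mulr_gt0// ln_gt0// ltr1n. Qed.

Let rho0 : 0 < rho. Proof. by rewrite sqrtr_gt0. Qed.
Let rho2 : rho ^+ 2 = d. Proof. by rewrite sqr_sqrtr// ltW. Qed.

Implicit Types (z y : @lattice_point N) (G : {set {set 'I_N}}).

Definition light_part z y (p : 'I_N * 'I_N) : R :=
  if (z p.1).1%:R * (y p.2).1%:R <= rho then coord z p.1 * coord y p.2 else 0.

Definition light_failure z y G :=
  42%:R * pairs * (rho * N%:R) <=
    \sum_(e in G) edge_form (light_part z y) e
      - \sum_e w e * edge_form (light_part z y) e.

Definition degree_failure (i : 'I_N) G :=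
  deg * d <= \sum_(e in G) (if i \in e then #|e|.-1%:R else 0).

(** Here [r = e 2^(m + 2) / rho], with [m] standing for the sum of two dyadic levels; each level is
    at most [4 N], whence the range [m <= 8 N] below. *)
Definition discrepancy_failure m (S T : {set 'I_N}) G :=
  expR 1 * (2 ^+ (m + 2) / rho) * (2 * d / N%:R * (#|S|%:R * #|T|%:R))
   + pairs * (theta + 6%:R) * ((entropy N #|S| + entropy N #|T|)
        / ln (expR 1 * (2 ^+ (m + 2) / rho)))
  <= \sum_(e in G) edge_form (fun p => ((p.1 \in S) && (p.2 \in T))%:R) e.

(** The three global failures are written in the form [P j && B j G] that [union_bound] takes. *)
Definition some_light_failure G :=
  [exists q : lattice_point * lattice_point,
     (in_net q.1 && in_net q.2) && light_failure q.1 q.2 G].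

Definition some_degree_failure G :=
  [exists i : 'I_N, true && degree_failure i G].

Definition some_discrepancy_failure G :=
  [exists q : 'I_(8 * N).+1 * ({set 'I_N} * {set 'I_N}),
    [&& 1 <= 2 ^+ (q.1 + 2) / rho, (0 < #|q.2.1|)%N & (0 < #|q.2.2|)%N]
      && discrepancy_failure q.1 q.2.1 q.2.2 G].

Lemma norm_coordM z y i j :
  `|coord z i * coord y j : R| = (z i).1%:R * (y j).1%:R.
Proof. by rewrite /coord !normrM !normrX !normrN1 !expr1n !mul1r !normr_nat. Qed.

Lemma sum_coordM_sqr z y : in_net z -> in_net y ->
  \sum_(p : 'I_N * 'I_N) (coord z p.1 * coord y p.2 : R) ^+ 2
    <= 16%:R * N%:R ^+ 2.
Proof.
move=> hz hy; have hz2 := sum_coord_sqr (R := R) _ hz.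
have hy2 := sum_coord_sqr (R := R) _ hy.
rewrite (eq_bigr (fun p => coord z p.1 ^+ 2 * coord y p.2 ^+ 2)); last first.
  by move=> p _; rewrite exprMn.
rewrite -(pair_bigA _ (fun i j => coord z i ^+ 2 * coord y j ^+ 2)) /=.
rewrite -big_distrlr /=.
have -> : 16%:R * N%:R ^+ 2 = (4 * N%:R) * (4 * N%:R) :> R by ring.
by rewrite ler_pM// sumr_ge0// => i _; exact: sqr_ge0.
Qed.

(** There are at most [64^(2 N) <= exp (12 N)] pairs of net points, against a tail of [exp (- 13 N)]
    each. *)
Lemma proba_light_failure :
  \sum_(G | some_light_failure G) law G <= expR (- N%:R).
Proof.
apply: (le_trans (union_bound law_ge0 _
  (fun q : lattice_point * lattice_point => in_net q.1 && in_net q.2)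
  (fun q => light_failure q.1 q.2))).
have tail z y : in_net z -> in_net y ->
    \sum_(G | light_failure z y G) law G <= expR (- (13%:R * N%:R)).
  move=> hz hy.
  apply: (light_tail N2 L2 LL2 LLL w01 law_ge0 law_incl dmax0 wLL wd d0).
    move=> p; rewrite /light_part; case: ifP => [h|_]; last exact: ltW.
    by apply: le_trans h; rewrite -norm_coordM; exact: ler_norm.
  apply: le_trans (sum_coordM_sqr _ _ hz hy); apply: ler_sum => p _.
  by rewrite /light_part; case: ifP => // _; rewrite expr0n sqr_ge0.
rewrite -(pair_big (fun z => in_net z) (fun y => in_net y)
  (fun z y => \sum_(G | light_failure z y G) law G)) /=.
apply: (@le_trans _ _ (\sum_(z | in_net z) \sum_(y | in_net y)
   expR (- (13%:R * N%:R) : R))).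
  by apply: ler_sum => z hz; apply: ler_sum => y hy; exact: tail.
set s := expR _; pose k := #|[pred z : @lattice_point N | in_net z]|.
have sum_net (x : R) : \sum_(z : @lattice_point N | in_net z) x = k%:R * x.
  by rewrite mulr_natl -sumr_const; apply: eq_bigl.
rewrite !sum_net.
have e1 : 64%:R <= expR 6%:R :> R.
  rewrite -[6%:R]mulr1 expRM_natl (_ : 64%:R = 2 ^+ 6); last by ring.
  by rewrite lerXn2r ?nnegrE ?expR_ge0//; have := expR_ge1Dx (1 : R).
have e2 : k%:R <= expR (6%:R * N%:R) :> R.
  rewrite expRM_natr; apply: (le_trans card_net).
  by rewrite lerXn2r ?nnegrE ?expR_ge0.
have -> : expR (- N%:R) = expR (6%:R * N%:R) *
    (expR (6%:R * N%:R) * expR (- (13%:R * N%:R))) :> R.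
  by rewrite -!expRD; congr expR; ring.
by rewrite ler_pM ?mulr_ge0 ?expR_ge0// ler_pM ?expR_ge0.
Qed.

Lemma proba_degree_failure :
  \sum_(G | some_degree_failure G) law G <= expR (- (theta * ln N%:R)).
Proof.
apply: (le_trans (union_bound law_ge0 _ xpredT degree_failure)).
apply: (@le_trans _ _ (\sum_(i < N) expR (- ((1 + theta) * ln N%:R)))).
  apply: ler_sum => i _.
  exact: (degree_tail L2 LLL w01 law_ge0 law_incl dmax0 wLL wd _ _ i c0 theta0).
rewrite sumr_const card_ord -[leLHS]mulr_natl -[X in X * _](lnK N0) -expRD.
by rewrite ler_expR; lra.
Qed.

(** The sum over pairs of nonempty sets factorizes, each factor being at most [N^(-theta - 4)]. The
    [8 N + 1 <= N^5] values of [m] leave [N^(-2 theta - 3)]. *)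
Lemma proba_discrepancy_failure :
  \sum_(G | some_discrepancy_failure G) law G <= expR (- (theta * ln N%:R)).
Proof.
apply: (le_trans (union_bound law_ge0 _
  (fun q : 'I_(8 * N).+1 * ({set 'I_N} * {set 'I_N}) =>
    [&& 1 <= 2 ^+ (q.1 + 2) / rho, (0 < #|q.2.1|)%N & (0 < #|q.2.2|)%N])
  (fun q => discrepancy_failure q.1 q.2.1 q.2.2))).
pose h (S : {set 'I_N}) : R := expR (- ((theta + 6%:R) * entropy N #|S|)).
have h0 S : 0 <= h S by exact: expR_ge0.
pose H1 : R := \sum_(S : {set 'I_N} | (0 < #|S|)%N) h S.
have H1le : H1 <= N%:R * expR (- ((theta + 5%:R) * ln N%:R)).
  have := @entropy_union R N (theta + 5%:R); rewrite /H1 /h.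
  have -> : 1 + (theta + 5%:R) = theta + 6%:R by ring.
  by apply; rewrite addr_ge0// ltW.
apply: (@le_trans _ _ (\sum_(m < (8 * N).+1) H1 * H1)).
  rewrite [leRHS](eq_bigr (fun _ => \sum_(q : {set 'I_N} * {set 'I_N} |
     (0 < #|q.1|)%N && (0 < #|q.2|)%N) h q.1 * h q.2)); last first.
    move=> m _; rewrite /H1 big_distrlr /= pair_big_dep /=.
    by apply: eq_big => // -[S T].
  rewrite [leRHS]pair_big_dep /= big_mkcond [leRHS]big_mkcond.
  apply: ler_sum => -[m [S T]] _ /=.
  case: (ltnP 0 #|S|) => _ /=; last by rewrite andbF.
  case: (ltnP 0 #|T|) => _ /=; last by rewrite andbF.
  rewrite andbT; case: ifP => [u1|_]; last by rewrite mulr_ge0.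
  have -> : h S * h T
      = expR (- ((theta + 6%:R) * (entropy N #|S| + entropy N #|T|))).
    by rewrite /h -expRD; congr expR; ring.
  apply: (discrepancy_tail N2 L2 LL2 LLL w01 law_ge0 law_incl dmax0 wLL wd d0) => //.
  by rewrite ler_peMr ?expR_ge0.
rewrite sumr_const card_ord -[leLHS]mulr_natl.
have e0 : expR (ln N%:R) = N%:R :> R by rewrite lnK.
have H10 : 0 <= H1 by apply: sumr_ge0 => S _.
have hN : (8 * N).+1%:R <= N%:R ^+ 5 :> R.
  have h2 : 2 <= N%:R :> R by rewrite ler_nat.
  have h4 : 4 <= N%:R ^+ 2 :> R by rewrite expr2; nra.
  have h16 : 16%:R <= N%:R ^+ 4 :> R by rewrite (exprM _ 2 2) [in leRHS]expr2; nra.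
  rewrite exprSr -natr1 natrM.
  by apply: (@le_trans _ _ (16%:R * N%:R)); [lra | rewrite ler_pM2r].
apply: (@le_trans _ _ (N%:R ^+ 5 * ((N%:R * expR (- ((theta + 5%:R) * ln N%:R)))
   * (N%:R * expR (- ((theta + 5%:R) * ln N%:R)))))).
  by rewrite ler_pM ?mulr_ge0// ler_pM.
rewrite -e0 -expRM_natl -!expRD expRK ler_expR.
have l0 : 0 <= ln N%:R :> R by rewrite ln_ge0// ler1n (leq_trans _ N2).
by have := mulr_ge0 (ltW theta0) l0; lra.
Qed.

Lemma row_edge_form (i : 'I_N) (e : {set 'I_N}) :
  edge_form (fun p => (p.1 == i)%:R) e = if i \in e then #|e|.-1%:R else 0 :> R.
Proof.
rewrite /edge_form /edge_pair.
rewrite -(pair_big_dep xpredT (fun k j => [&& k != j, k \in e & j \in e])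
  (fun k j => (k == i)%:R)) /=.
rewrite (bigD1 i)//= [X in _ + X]big1 ?addr0; last first.
  by move=> k /negbTE ki; rewrite ki big1.
rewrite eqxx; case: ifPn => ie; last by rewrite big_pred0// => j; rewrite andbF.
rewrite -natr_sum sum1_card (cardD1 i e) ie /=; congr _%:R.
by apply: eq_card => j; rewrite !inE unfold_in eq_sym.
Qed.

Lemma adjacency_sym G i j : adjacency R G i j = adjacency R G j i.
Proof.
rewrite !mxE eq_sym; case: eqP => // _; congr (_%:R).
by apply: eq_card => e; rewrite !inE (andbC (i \in e)).
Qed.

(** Pair the adjacency matrix with the indicator of row [i]; an edge through [i] contributes its
    other vertices. *)
Lemma sum_adjacency_row G i : \sum_j adjacency R G i j
  = \sum_(e in G) (if i \in e then #|e|.-1%:R else 0).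
Proof.
rewrite -(eq_bigr _ (fun e _ => row_edge_form i e)) -sum_adjacency.
rewrite -(pair_bigA _ (fun k j => (k == i)%:R * adjacency R G k j)) /=.
rewrite [RHS](bigD1 i)//= [X in _ = _ + X]big1 ?addr0; last first.
  by move=> k /negbTE ->; rewrite big1// => j _; rewrite mul0r.
by apply: eq_bigr => j _; rewrite eqxx mul1r.
Qed.

Definition mean_adjacency : 'M[R]_N := \matrix_(i, j)
  if i == j then 0 else \sum_(e : {set 'I_N} | (i \in e) && (j \in e)) w e.

(** The light pairs give [42 pairs], the mean over heavy pairs 32, and the adjacency over heavy
    pairs the bound of [heavy_pairs] with [K = X] and [k = deg]. *)
Lemma adjacency_norm_le G :
  ~~ some_light_failure G -> ~~ some_degree_failure G ->
  ~~ some_discrepancy_failure G ->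
  spectral_norm (adjacency R G - mean_adjacency)
    <= 512%:R * L%:R * L.-1%:R * (theta + 6%:R) * deg * rho.
Proof.
move=> nlight ndeg ndisc.
have L1 : 1 <= L.-1%:R :> R by rewrite ler1n -ltnS prednK// (leq_trans _ L2).
have pairs2 : 2 <= pairs.
  have : 2 <= L%:R :> R by rewrite ler_nat.
  by rewrite /pairs; nra.
have deg2 : 2 <= deg.
  have t1 : 0 <= 1 + theta by rewrite addr_ge0// ltW.
  by rewrite /deg lerDl; exact: divr_ge0 (mulr_ge0 _ t1) (ltW c0).
have deg0 : 0 <= deg by apply: le_trans deg2.
set X := pairs * (theta + 6%:R).
have pairs0 : 0 <= pairs by apply: le_trans pairs2.
have X12 : 6%:R * pairs <= X by rewrite /X mulrC ler_wpM2l// lerDr ltW.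
apply: (@le_trans _ _
  ((42%:R * pairs + 32%:R + (1536%:R + 160%:R * X + 64%:R * deg)) * rho)).
  apply: spectral_norm_le_net => [|z y hz hy]; first exact: (leq_trans _ N2).
  rewrite pair_bigA /= -[leRHS]mulrA [leRHS]mulrDl [X in _ <= X + _]mulrDl.
  pose heavy (p : 'I_N * 'I_N) := rho < (z p.1).1%:R * (y p.2).1%:R.
  have -> : \sum_p coord z p.1 * coord y p.2
        * (adjacency R G - mean_adjacency) p.1 p.2
    = (\sum_(e in G) edge_form (light_part z y) e
        - \sum_e w e * edge_form (light_part z y) e)
      + \sum_(p | heavy p) coord z p.1 * coord y p.2
          * (adjacency R G - mean_adjacency) p.1 p.2.
    rewrite -sum_adjacency sum_edge_form [X in _ = _ + X]big_mkcond -sumrB.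
    rewrite -big_split /=; apply: eq_bigr => p _.
    rewrite /heavy /light_part ltNge !mxE; case: leP => _ /=.
      by rewrite addr0 mulrBr.
    by rewrite !mul0r subr0 add0r.
  rewrite -[leRHS]addrA; apply: lerD.
    move/existsPn : nlight => /(_ (z, y)); rewrite /= hz hy /= /light_failure.
    by rewrite -ltNge => /ltW.
  apply: (@le_trans _ _ (\sum_(p | heavy p) (z p.1).1%:R * (y p.2).1%:R
      * mean_adjacency p.1 p.2 + \sum_(p | heavy p) (z p.1).1%:R * (y p.2).1%:R
      * adjacency R G p.1 p.2)).
    rewrite -big_split; apply: ler_sum => p _ /=.
    rewrite -mulrDr -norm_coordM; apply: le_trans (ler_norm _) _.
    rewrite normrM ler_wpM2l//.
    have mean0 : 0 <= mean_adjacency p.1 p.2.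
      rewrite mxE; case: ifP => // _; rewrite sumr_ge0// => e _.
      by have /andP[] := w01 e.
    have adj0 : 0 <= adjacency R G p.1 p.2 by rewrite mxE; case: ifP.
    rewrite [_ p.1 p.2]mxE [X in _ + X]mxE ler_norml; lra.
  apply: lerD.
    (* On heavy pairs [q = |z_i y_j| > rho] gives [q <= q^2 / rho], while entries of the mean are at
       most [2 d / N]. *)
    apply: (@le_trans _ _ (2 * d / N%:R / rho *
        \sum_(p : 'I_N * 'I_N) (coord z p.1 * coord y p.2) ^+ 2)).
      rewrite mulr_sumr big_mkcond; apply: ler_sum => p _.
      have c1 : 0 <= 2 * d / N%:R.
        exact: divr_ge0 (mulr_ge0 _ (ltW d0)) (ltW N0).
      case: ifP => [hp|_]; last first.
        exact: mulr_ge0 (divr_ge0 c1 (ltW rho0)) (sqr_ge0 _).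
      have -> : (coord z p.1 * coord y p.2) ^+ 2
          = ((z p.1).1%:R * (y p.2).1%:R) ^+ 2 :> R.
        by rewrite -norm_coordM real_normK ?num_real.
      rewrite /heavy in hp; set q : R := (z p.1).1%:R * (y p.2).1%:R in hp *.
      have q0 : 0 <= q by rewrite mulr_ge0.
      have mean_le : mean_adjacency p.1 p.2 <= 2 * d / N%:R.
        rewrite mxE; case: ifPn => // pn.
        exact: (pair_weight_le LL2 dmax0 wLL wd).
      apply: (@le_trans _ _ (q * (2 * d / N%:R))); first exact: ler_wpM2l.
      have -> : 2 * d / N%:R / rho * q ^+ 2 = q * (2 * d / N%:R) * (q / rho).
        by ring.
      by rewrite ler_peMr ?(mulr_ge0 q0 c1)// ler_pdivlMr// mul1r ltW.
    have -> : 32%:R * (rho * N%:R)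
        = 2 * d / N%:R / rho * (16%:R * N%:R ^+ 2).
      by rewrite -rho2; field; rewrite !gt_eqF.
    apply: ler_wpM2l; last exact: sum_coordM_sqr.
    exact: divr_ge0 (divr_ge0 (mulr_ge0 _ (ltW d0)) (ltW N0)) (ltW rho0).
  have row i : \sum_j adjacency R G i j <= deg * rho ^+ 2.
    rewrite rho2 sum_adjacency_row; apply: ltW; rewrite ltNge.
    by move/existsPn : ndeg => /(_ i).
  have X0 : 0 <= X by apply: le_trans X12; exact: mulr_ge0.
  apply: (heavy_pairs _ rho0 deg0 X0 _ row _ _
    (fun i => (z i).1) (fun i => (y i).1)) => //; first exact: leq_trans N2.
  - by move=> i j; rewrite mxE; case: ifP.
  - by move=> j; under eq_bigr do rewrite adjacency_sym; exact: row.
  move=> S T m mN u1.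
  have r0 : 0 < 2 ^+ (m + 2) / rho by exact: lt_le_trans u1.
  have rhs0 : 0 <= X * ((entropy N #|S| + entropy N #|T|)
      / (1 + ln (2 ^+ (m + 2) / rho))).
    rewrite mulr_ge0// divr_ge0 ?addr_ge0 ?ln_ge0//.
      by rewrite entropy_ge0// -[leqRHS]card_ord max_card.
    by rewrite entropy_ge0// -[leqRHS]card_ord max_card.
  have rhs1 : 0 <= expR 1 * (2 ^+ (m + 2) / rho) *
     (2 * rho ^+ 2 / N%:R * (#|S|%:R * #|T|%:R)).
    rewrite rho2; apply: mulr_ge0; first exact: mulr_ge0 (expR_ge0 _) (ltW r0).
    apply: mulr_ge0; last by rewrite mulr_ge0.
    exact: divr_ge0 (mulr_ge0 _ (ltW d0)) (ltW N0).
  have rhs := addr_ge0 rhs1 rhs0.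
  (* Failure events only range over nonempty sets; for an empty one the left side is 0. *)
  have [/cards0_eq S0|S0] := posnP #|S|.
    by apply: le_trans rhs; rewrite S0 big_set0.
  have [/cards0_eq T0|T0] := posnP #|T|.
    by apply: le_trans rhs; rewrite big1// => i _; rewrite T0 big_set0.
  have -> : \sum_(i in S) \sum_(j in T) adjacency R G i j
      = \sum_(e in G) edge_form (fun p => ((p.1 \in S) && (p.2 \in T))%:R) e.
    rewrite -sum_adjacency pair_big_dep /= big_mkcond; apply: eq_bigr => p _.
    by case: (_ && _); rewrite ?mul1r ?mul0r.
  apply: ltW; rewrite ltNge; move/existsPn : ndisc.
  move=> /(_ (Ordinal (mN : (m < (8 * N).+1)%N), (S, T))) /=.
  rewrite u1 S0 T0 /= /discrepancy_failure /= rho2.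
  (* [ln (e u) = 1 + ln u] matches the denominator in the two discrepancy bounds. *)
  by rewrite lnM ?posrE ?expR_gt0// expRK.
have -> : 512%:R * L%:R * L.-1%:R * (theta + 6%:R) * deg = 512%:R * (X * deg).
  by rewrite /X /pairs; ring.
rewrite ler_pM2r//.
(* [X >= 12] and [deg >= 2] let [X deg] dominate every term. *)
have : 2 * X <= X * deg by rewrite mulrC ler_wpM2l//; lra.
have : 12%:R * deg <= X * deg by rewrite ler_wpM2r//; lra.
by lra.
Qed.

(** Each [G] satisfies the norm bound or belongs to a failure event. Degrees and discrepancy cost
    [N^(-theta)] each, light pairs [exp (- N)]. *)
Lemma proba_norm_le :
  1 - 2 * expR (- (theta * ln N%:R)) - expR (- N%:R)
    <= \sum_(G | spectral_norm (adjacency R G - mean_adjacency)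
         <= 512%:R * L%:R * L.-1%:R * (theta + 6%:R) * deg * rho) law G.
Proof.
have h1 := proba_light_failure; have h2 := proba_degree_failure.
have h3 := proba_discrepancy_failure.
suff : 1 <= \sum_(G | spectral_norm (adjacency R G - mean_adjacency)
         <= 512%:R * L%:R * L.-1%:R * (theta + 6%:R) * deg * rho) law G
    + \sum_(G | some_light_failure G) law G
    + \sum_(G | some_degree_failure G) law G
    + \sum_(G | some_discrepancy_failure G) law G by lra.
rewrite -[leLHS](law_total law_incl) [X in _ <= X + _ + _ + _]big_mkcond.
rewrite [X in _ <= _ + X + _ + _]big_mkcond [X in _ <= _ + X + _]big_mkcond.
rewrite [X in _ <= _ + X]big_mkcond -!big_split /=; apply: ler_sum => G _.
have if0 (b : bool) : 0 <= if b then law G else 0 by case: b.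
have [_|nl] := boolP (some_light_failure G).
  by rewrite addrAC addrA -addrA addrAC lerDr !addr_ge0.
have [_|nd] := boolP (some_degree_failure G).
  by rewrite addr0 addrAC lerDr addr_ge0.
have [_|nD] := boolP (some_discrepancy_failure G).
  by rewrite !addr0 lerDr.
by rewrite (adjacency_norm_le _ nl nd nD) !addr0.
Qed.

End HypergraphNorm.

(** * Transfer to the random hypergraph and conclusion *)

Lemma expected_adjacencyE {R : realType} {disp : measure_display}
    {T : measurableType disp} {P : probability T R} {N : nat}
    {D : {set {set 'I_N}}} {H : T -> {set {set 'I_N}}} :
  (forall x e, e \in H x -> e \in D) ->
  independent_events P D (fun e => [set x | e \in H x]) ->
  expected_adjacency P H = mean_adjacency (w := inclusion_proba (P := P) H).
Proof.
move=> HD Hind; apply/matrixP => i j; rewrite !mxE.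
under eq_fun do rewrite mxE.
case: eqP => _; first by rewrite (expectation_cst P 0).
by rewrite (expectation_card HD Hind (fun e => (i \in e) && (j \in e))).
Qed.

Theorem theorem3p2 (R : realType) (disp : measure_display)
    (T : measurableType disp) (P : probability T R)
    (N : nat) (LL : {fset nat}) (L : nat)
    (dt : forall l : nat, tensor R N l) (H : T -> {set {set 'I_N}})
    (c theta : R) :
  (forall l, l \in LL -> (2 <= l)%N) ->
  L \in LL ->
  (forall l, l \in LL -> (l <= L)%N) ->
  erdos_renyi_hypergraph P LL (edge_probability dt) H ->
  let d := \sum_(l <- LL) (l.-1)%:R * max_entry (dt l) in
  0 < c ->
  c * ln N%:R <= d ->
  0 < theta ->
  let C := 512%:R * L%:R * (L.-1)%:R * (theta + 6%:R)
           * (2%:R + (L.-1)%:R * (1 + theta) / c) in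
  (P [set w | (spectral_norm (adjacency R (H w) - expected_adjacency P H)
               <= C * Num.sqrt d)%R]
   >= (1 - 2%:R * N%:R `^ (- theta) - 2%:R * expR (- N%:R))%:E)%E.
Proof.
move=> LL2 LLL Lmax [_ Hsize Hprob Hind] d c0 cd theta0; cbv zeta.
(* For [N <= 1] the claimed lower bound on the probability is negative; for [N >= 2], [ln N > 0]
   makes [d] positive. *)
have [N2|N1] := leqP 2 N; last first.
  apply: (@le_trans _ _ 0%E); last exact: measure_ge0.
  rewrite lee_fin; have p0 := powR_ge0 (N%:R : R) (- theta).
  case: N N1 {dt H Hsize Hprob Hind d cd} p0 => [|[|//]] _ p0.
    by rewrite oppr0 expR0; lra.
  by rewrite powR1; have := expR_gt0 (- 1 : R); lra.
have L2 := LL2 _ LLL.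
have HD x e : e \in H x -> e \in [set e : {set 'I_N} | #|e| \in LL]%SET.
  by move=> /Hsize; rewrite inE.
pose w := inclusion_proba (P := P) H.
pose law := law_of (P := P) H.
have w01 e : 0 <= w e <= 1 := inclusion_proba01 HD Hind e.
have law_ge0 G : 0 <= law G := law_of_ge0 G.
have law_incl := law_of_incl HD Hind.
have dmax0 l : 0 <= max_entry (dt l) by exact: bigmax_ge_id.
have wLL (e : {set 'I_N}) : #|e| \notin LL -> w e = 0.
  by move=> eLL; rewrite /w /inclusion_proba (inclusion_notin HD) ?measure0// inE.
have wd (e : {set 'I_N}) : #|e| \in LL ->
    w e <= max_entry (dt #|e|) / 'C(N.-1, #|e|.-1)%:R.
  (* Tensors are indexed by tuples, so the set [e] is listed as a tuple of distinct vertices. *)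
  move=> eLL; pose t := enum_tuple (mem e).
  have te : [set i in t]%SET = e by apply/finset.setP => i; rewrite !inE mem_enum.
  have := Hprob _ t eLL (enum_uniq _); rewrite te /w /inclusion_proba => ->.
  rewrite /edge_probability /= ler_wpM2r ?invr_ge0//.
  exact: (le_bigmax_cond _ _ (enum_uniq _)).
rewrite (expected_adjacencyE HD Hind).
rewrite (proba_law HD Hind (fun G =>
  spectral_norm (adjacency R G - mean_adjacency (w := w)) <= _ * Num.sqrt d)).
rewrite lee_fin; apply: le_trans (proba_norm_le N2 L2 LL2 Lmax w01 law_ge0
  law_incl dmax0 wLL wd c0 theta0 cd).
rewrite /powR pnatr_eq0 gtn_eqF ?(ltn_trans _ N2)// mulNr.
by have := expR_gt0 (- N%:R : R); lra.
Qed.
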